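(* Let $B\in\mathbb Z_{\ge1}$, $r,t>0$, $T=(1+r)t$, $z>0$, $\hat S_{t,T}:=S_t\big((1+r)^{\phi_1/S_t}-1\big)$, $p\in(0,1)$ and $q:=1-p$. Suppose that $\mu\prec B$ and that for some constants $c>0$ and $\alpha\in(0,1)$ we have $|\nu(x)-cx^{-\alpha}|\le f(x)$ for all $x\in\mathbb R_{>0}$, where $f\ge0$ is such that $\mathcal L[f](u)<\infty$ for all $u>0$. Let $$d(z):=\frac{pz\,c\Gamma(1-\alpha)t^\alpha(1+r)^{-\alpha}}{(1+2\log(1+r))\,c\Gamma(1-\alpha)t^\alpha+pz(2-\alpha)\log(1+r)(1+r)^{-\alpha}},$$ and suppose that $$T\mathcal L[f](T)\le qz,\qquad t\mathcal L[f](t)\le d(z),\qquad -t^2\mathcal L[f]'(t)\le d(z).$$ Then $$\begin{aligned} P(|\hat S_{t,T}-S_{t,T}|>z)\le{}&\exp\left(-\frac{(qz-T\mathcal L[f](T))^2}{2B\,\mathbb E[S_T]}\right)+\exp\left(-\frac{(qz-T\mathcal L[f](T))^2}{2B\,\mathbb E[S_T]+\frac23B(qz-T\mathcal L[f](T))}\right)\\ &+\exp\left(-\frac{(d(z)-t\mathcal L[f](t))^2}{2B\,\mathbb E[S_t]}\right)+\exp\left(-\frac{(d(z)-t\mathcal L[f](t))^2}{2B\,\mathbb E[S_t]+\frac23B(d(z)-t\mathcal L[f](t))}\right)\\ &+\exp\left(-\frac{(d(z)+t^2\mathcal L[f]'(t))^2}{(4B-2)\,\mathbb E[S_t^{(2)}]}\right)\\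 &+\exp\left(-\frac{(d(z)+t^2\mathcal L[f]'(t))^2}{(4B-2)\,\mathbb E[S_t^{(2)}]+\frac{4B-2}{3}(d(z)+t^2\mathcal L[f]'(t))}\right). \end{aligned}$$
   Context: Setting (Poissonized generalized unseen species problem). $\mathcal{S}$ is an at most countable set of species and $\mu$ is a probability measure on $2^{\mathcal S}$ supported on finite sets; $\mu\prec B$ means $\mu(A)=0$ whenever $|A|>B$. $t,t'>0$, $r=t'/t$, $T=t+t'=(1+r)t$. Let $X_1,X_2,\dots$ be i.i.d. from $\mu$, and let $n\sim\mathrm{Poisson}(t)$, $m\sim\mathrm{Poisson}(t')$ be independent of each other and of the $X_i$. The first expedition observes $X_1,\dots,X_n$, the second $X_{n+1},\dots,X_{n+m}$. For $s\in\mathcal S$, $N_s$ (resp. $N_s'$) is the number of sets observed in the first (resp. second) expedition that contain $s$. $S_t=|\{s:N_s>0\}|$, $S_T=|\{s:N_s+N_s'>0\}|$, $S_{t,T}=S_T-S_t$. $\phi_1=|\{s:N_s=1\}|$ and $S_t^{(2)}=|\{s:N_s\ge2\}|$. For $s\in\mathcal S$, $M_s=\sum_{A\ni s}\mu(A)$, and $\nu(x)=\sum_{s\in\mathcal S}1_{M_s>x}$. $\mathcal L[f](u)=\int_0^\infty f(x)e^{-ux}\,dx$ is the Laplace transform and $\mathcal L[f]'$ its derivative. When $S_t=0$ the estimator is interpreted as $0$. *)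

(* Defs.v *)
From HB Require Import structures.
From mathcomp Require Import all_boot all_order all_algebra.
From mathcomp Require Import finmap.
From mathcomp Require Import all_classical all_reals all_analysis.

Set Implicit Arguments.
Unset Strict Implicit.
Unset Printing Implicit Defensive.

Import Order.TTheory GRing.Theory Num.Theory.
Import numFieldNormedType.Exports.

Local Open Scope classical_set_scope.
Local Open Scope ring_scope.

(* A probability measure on the power set of a countable set [S] that is
   supported on finite sets is a probability measure on the countable type
   [{fset S}], equipped with the discrete sigma-algebra. *)
Section fset_measurable.
Variable S : countType.

HB.instance Definition _ := @isMeasurable.Build default_measure_display
  {fset S} discrete_measurable discrete_measurable0
  discrete_measurableC discrete_measurableU.

End fset_measurable.

Section species_distribution.
Variables (S : countType) (R : realType) (mu : probability {fset S} R).
Local Open Scope ereal_scope.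

Definition size_bounded (B : nat) : Prop :=
  forall A : {fset S}, (B < #|` A|)%N -> mu [set A] = 0.

Definition incidence_prob (s : S) : \bar R :=
  \esum_(A in [set A : {fset S} | s \in A]) mu [set A].

Definition incidence_count (x : R) : \bar R :=
  \esum_(s in [set: S]) (x%:E < incidence_prob s)%E%:R%:E.

End species_distribution.

Section independence.
Context d (Omega : measurableType d) (R : realType) (P : probability Omega R).

Definition mutually_independent (I : choiceType) (F : I -> set_system Omega) :=
  forall (J : {fset I}) (E : I -> set Omega), (forall i, i \in J -> F i (E i)) ->
    P (\bigcap_(i in [set` J]) E i) = (\prod_(i <- J) P (E i))%E.

End independence.

Section sampling.
Context d (Omega : measurableType d) (R : realType) (P : probability Omega R).
Variables (S : countType) (X : nat -> {RV P >-> {fset S}}) (n m : {RV P >-> nat}).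

Definition sampling_sigma (i : bool + nat) : set_system Omega :=
  match i with
  | inl false => preimage_set_system [set: Omega] n measurable
  | inl true => preimage_set_system [set: Omega] m measurable
  | inr k => preimage_set_system [set: Omega] (X k) measurable
  end.

Record poisson_sampling (mu : probability {fset S} R) (t t' : R) : Prop := {
  sampling_law : forall k A, distribution P (X k) A = mu A ;
  sampling_poisson1 : forall k, distribution P n [set k] = (poisson_pmf t k)%:E ;
  sampling_poisson2 : forall k, distribution P m [set k] = (poisson_pmf t' k)%:E ;
  sampling_indep : mutually_independent P sampling_sigma }.

(* Samples are indexed from 0: the first expedition observes
   [X 0, ..., X (n - 1)], the second one [X n, ..., X (n + m - 1)]. *)
Definition count1 (s : S) (w : Omega) : nat :=
  (\sum_(0 <= i < n w) (s \in X i w))%N.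

Definition count2 (s : S) (w : Omega) : nat :=
  (\sum_(n w <= i < n w + m w) (s \in X i w))%N.

(* [fset_set] is only meaningful on finite sets; see [finite_observed]. *)
Definition num_species (A : set S) : nat := #|` fset_set A|.

Lemma finite_observed (w : Omega) :
  finite_set [set s | (0 < count1 s w + count2 s w)%N].
Proof.
apply: (@sub_finite_set _ _ (\bigcup_(i in `I_(n w + m w)) [set` X i w])).
  move=> s; rewrite /= /count1 /count2 -big_cat_nat ?leq_addr//=.
  rewrite lt0n sum_nat_seq_neq0 => /hasP[i].
  rewrite mem_index_iota leq0n => /= ilt; rewrite eqb0 negbK => sX; by exists i.
apply: bigcup_finite; first exact: finite_II.
by move=> i _; exact: finite_fset.
Qed.

Definition seen1 (w : Omega) : nat :=
  num_species [set s | (0 < count1 s w)%N].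

Definition seen12 (w : Omega) : nat :=
  num_species [set s | (0 < count1 s w + count2 s w)%N].

Definition singletons (w : Omega) : nat :=
  num_species [set s | count1 s w = 1%N].

Definition seen_twice (w : Omega) : nat :=
  num_species [set s | (2 <= count1 s w)%N].

Definition unseen (w : Omega) : R := (seen12 w)%:R - (seen1 w)%:R.

(* Null when [seen1 w = 0], whatever the value of the ill-defined exponent. *)
Definition unseen_estimator (r : R) (w : Omega) : R :=
  (seen1 w)%:R * ((1 + r) `^ ((singletons w)%:R / (seen1 w)%:R) - 1).

End sampling.

Section analysis.
Variable R : realType.

Definition laplace (f : R -> R) (u : R) : R :=
  \int[lebesgue_measure]_(x in `]0, +oo[) (f x * expR (- (u * x))).

Definition laplace_finite (f : R -> R) : Prop :=
  forall u : R, 0 < u ->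
    (\int[lebesgue_measure]_(x in `]0%R, +oo[) (f x * expR (- (u * x)))%:E < +oo)%E.

Definition Gamma (a : R) : R :=
  \int[lebesgue_measure]_(x in `]0, +oo[) (x `^ (a - 1) * expR (- x)).

Definition deviation (p c alpha r t z : R) : R :=
  (p * z * c * Gamma (1 - alpha) * t `^ alpha * (1 + r) `^ (- alpha)) /
  ((1 + 2 * ln (1 + r)) * c * Gamma (1 - alpha) * t `^ alpha
   + p * z * (2 - alpha) * ln (1 + r) * (1 + r) `^ (- alpha)).

End analysis.

(* Main.v *)
Require Import Defs.
From mathcomp Require Import all_boot all_order all_algebra.
From mathcomp Require Import finmap.
From mathcomp Require Import all_classical all_reals all_analysis.
From mathcomp Require Import measurable_realfun.
From mathcomp Require Import ring lra.

Set Implicit Arguments.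
Unset Strict Implicit.
Unset Printing Implicit Defensive.

Import Order.TTheory GRing.Theory Num.Theory.
Import numFieldNormedType.Exports.

Local Open Scope classical_set_scope.
Local Open Scope ring_scope.

(** Write [x], [y] and [xT] for the numbers of species seen in the first
    expedition, seen at least twice in it, and seen in the two expeditions, and
    [l] for [ln (1 + r)].  The estimator plus [x] is
    [x * exp (l * (1 - y / x))], and the unseen count plus [x] is [xT]; so the
    error is at most the distance of [xT] to [K * (1 + r) `^ alpha] plus that of
    [x * exp (l * (1 - y / x))] to the same number, where
    [K = c * Gamma (1 - alpha) * t `^ alpha].

    Means.  A species of incidence [M] is seen in the first expedition with
    probability [1 - exp (- t * M)], the integral of [t * exp (- t * x)] over
    [0 < x < M].  Summing over the species, the mean of [x] is [t] times the
    Laplace transform at [t] of the incidence count; similarly the mean of [y]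
    is minus [t ^ 2] times the derivative of that transform.  Replacing the
    incidence count by [c * x ^ (- alpha)] turns these means into [K] and
    [(1 - alpha) * K], with an error controlled by the transform of [f]
    ([species_mean_deviation], [repeated_species_mean_deviation]).

    Stability.  If [x] is within [deviation] of [K] and [y] within [deviation]
    of [(1 - alpha) * K], the exponential expression is within [p * z] of
    [K * (1 + r) `^ alpha] ([estimator_deviation]); [deviation] is what makes
    this estimate come out exactly.

    Concentration.  It remains to bound the probabilities that the three counts
    leave a neighbourhood of their means; each contributes two exponentials.
    Let [Z] be the number of species that occur at least [k] times in a Poisson
    sample.  Conditioning on the event that a species occurs at least [k] times
    is dominated by adding to the sample [k] sets that contain it, and this adds
    at most [C = 1 + k * (B - 1)] to [Z].  Therefore, for [th >= 0],
    [E (Z * exp (th * Z)) <= E Z * exp (th * C) * E (exp (th * Z))], with the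
    opposite inequality for [th <= 0] ([species_tilted_le],
    [species_tilted_ge]).  This is a differential inequality for the moment
    generating function, which it bounds by that of [C] times a Poisson variable
    ([mgf_le]), and Chernoff bounds follow.  For [k = 1] and [k = 2] the constant
    [C] is [B] and [2 * B - 1].

    The domination is proved by thinning: the sets that contain the species and
    those that do not form independent Poisson samples ([poisson_thinning]), so
    only the number [N] of the former matters.  The law of [N] given [N >= k] has
    with respect to the law of [N + k] a nonincreasing density, and Chebyshev's
    association inequality applies ([poisson_tilting_le]). *)

(** * Stability of the estimator *)

Section estimator_stability.
Variable R : realType.
Implicit Types (x y k al d l v : R).

Lemma expR_le_inv1B v : v < 1 -> expR v <= (1 - v)^-1.
Proof.
move=> v1; rewrite -[v]opprK expRN lef_pV2 ?posrE ?expR_gt0//; last lra.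
by rewrite opprK; have := expR_ge1Dx (- v); lra.
Qed.

(** A first-order expansion of the exponential suffices: [x * (1 + s / x)] is
    linear in [x] and [s]. *)
Lemma estimator_lower x y k al d l (x0 : 0 <= x) (yx : y <= x) (l0 : 0 <= l)
    (al01 : 0 < al < 1) (hx : k - d <= x) (hxu : x <= k + d)
    (hy : y <= (1 - al) * k + d) :
  k - d - (2 - al) * d * l <= x * expR (l * ((1 - al) - y / x)).
Proof.
have [xz|xn0] := eqVneq x 0.
  by rewrite xz mul0r; have : 0 <= (2 - al) * d * l; [apply: mulr_ge0 => //; nra|lra].
have xp : 0 < x by rewrite lt_neqAle eq_sym xn0.
apply: (@le_trans _ _ (x * (1 + l * ((1 - al) - y / x)))); last first.
  by rewrite ler_pM2l// expR_ge1Dx.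
have -> : x * (1 + l * ((1 - al) - y / x)) = x + l * ((1 - al) * x - y).
  by field.
have : l * (- ((2 - al) * d)) <= l * ((1 - al) * x - y) by apply: ler_wpM2l => //; nra.
lra.
Qed.

(** At fixed [y >= 0] the expression is nondecreasing in [x], which may thus be
    moved to the end point [k + d].  There the exponent is less than 1, so that
    [exp v <= 1 / (1 - v)] applies; at the original [x], possibly close to [0],
    it need not be. *)
Lemma estimator_upper x y k al d l (x0 : 0 <= x) (y0 : 0 <= y) (l0 : 0 <= l)
    (k0 : 0 < k) (d0 : 0 <= d)
    (al01 : 0 < al < 1) (hxu : x <= k + d) (hy : (1 - al) * k - d <= y)
    (hd : (2 - al) * d * l < k) :
  x * expR (l * ((1 - al) - y / x)) <=
  k + d + k * ((2 - al) * d * l) / (k - (2 - al) * d * l).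
Proof.
have kd0 : 0 < k + d by lra.
set e := (2 - al) * d * l.
have e0 : 0 <= e by rewrite /e !mulr_ge0//; lra.
have ekd : e / (k + d) < 1 by rewrite ltr_pdivrMr// mul1r; rewrite -/e in hd; lra.
have step : x * expR (l * ((1 - al) - y / x)) <= (k + d) * expR (e / (k + d)).
  have [xz|xn0] := eqVneq x 0.
    by rewrite xz mul0r mulr_ge0 ?expR_ge0//; lra.
  have xp : 0 < x by rewrite lt_neqAle eq_sym xn0.
  apply: ler_pM; rewrite ?expR_ge0//.
  rewrite ler_expR; apply: (@le_trans _ _ (l * ((1 - al) - y / (k + d)))).
    apply: ler_wpM2l => //; rewrite lerD2l lerN2; apply: ler_wpM2l => //.
    by rewrite lef_pV2.
  rewrite ler_pdivlMr//.
  have -> : l * ((1 - al) - y / (k + d)) * (k + d) = l * ((1 - al) * (k + d) - y).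
    by field; lra.
  by rewrite /e [leRHS]mulrC; apply: ler_wpM2l => //; nra.
apply: (le_trans step); rewrite -/e in hd *.
apply: (@le_trans _ _ ((k + d) * (1 - e / (k + d))^-1)).
  by rewrite ler_pM2l// expR_le_inv1B.
have -> : (k + d) * (1 - e / (k + d))^-1 = k + d + (k + d) * e / (k + d - e).
  by field; lra.
rewrite lerD2l ler_pdivlMr; last lra.
rewrite mulrAC ler_pdivrMr; last lra.
nra.
Qed.

(** The radius [d] is the solution of
    [w * (k - (2 - al) * d * l) = (1 + 2 * l) * d * k], which absorbs the error
    terms of the two one-sided bounds. *)
Lemma estimator_deviation x y k al d l w (x0 : 0 <= x) (y0 : 0 <= y)
    (yx : y <= x) (l0 : 0 < l) (k0 : 0 < k) (al01 : 0 < al < 1) (w0 : 0 < w)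
    (hd : d = w * k / ((1 + 2 * l) * k + w * (2 - al) * l))
    (hx : `|x - k| <= d) (hy : `|y - (1 - al) * k| <= d) :
  `|x * expR (l * ((1 - al) - y / x)) - k| <= w.
Proof.
have D0 : 0 < (1 + 2 * l) * k + w * (2 - al) * l.
  by apply: addr_gt0; rewrite !mulr_gt0//; lra.
have dp : 0 < d by rewrite hd divr_gt0// mulr_gt0.
have hd' : d * ((1 + 2 * l) * k + w * (2 - al) * l) = w * k.
  by rewrite hd divfK// gt_eqF.
have wE : w * (k - (2 - al) * d * l) = d * (1 + 2 * l) * k by nra.
have el : (2 - al) * d * l < k.
  have : 0 < w * (k - (2 - al) * d * l) by rewrite wE !mulr_gt0//; lra.
  by rewrite pmulr_rgt0//; lra.
have e0 : 0 < (2 - al) * d * l by rewrite !mulr_gt0//; lra.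
have dl0 : 0 < d * l by rewrite mulr_gt0.
move: hx hy; rewrite !ler_distl => /andP[hx1 hx2] /andP[hy1 hy2].
have lo := estimator_lower x0 yx (ltW l0) al01 hx1 hx2 hy2.
have up := estimator_upper x0 y0 (ltW l0) k0 (ltW dp) al01 hx2 hy1 el.
apply/andP; split.
  apply: le_trans lo; have : d * (1 + 2 * l) <= w.
    rewrite -(@ler_pM2r _ k)// -wE ler_pM2l//; lra.
  nra.
apply: (le_trans up); rewrite -addrA lerD2l.
have wE' : w = d * (1 + 2 * l) * k / (k - (2 - al) * d * l).
  by rewrite -wE mulfK//; lra.
rewrite [leRHS]wE'.
have ke : 0 < k - (2 - al) * d * l by lra.
rewrite ler_pdivlMr// mulrDl divfK; last lra.
have : 0 < d * ((2 - al) * d * l) by rewrite mulr_gt0.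
have : 0 < k * (d * l) * al by rewrite !mulr_gt0//; lra.
lra.
Qed.

End estimator_stability.

(** * Concentration from a size-bias comparison *)

Section exponential_inequalities.
Variable R : realType.
Implicit Types (f df : R -> R) (a b u x : R).

Lemma ge0_derive_le f df a b : a <= b ->
  (forall x, is_derive x 1 f (df x)) ->
  (forall x, a <= x <= b -> 0 <= df x) -> f a <= f b.
Proof.
rewrite le_eqVlt => /predU1P[->//|ab] fdf df0.
have cf : {within `[a, b], continuous f}.
  apply: derivable_within_continuous => x _.
  by have [] := fdf x.
have [c] := @MVT _ f df a b ab (fun x _ => fdf x) cf.
rewrite in_itv/= => /andP[ac cb] fE.
by rewrite -subr_ge0 fE mulr_ge0 ?subr_ge0 ?df0 ?(ltW ab)// !ltW.
Qed.

Lemma expR_ge1DxD2 u : 0 <= u -> 1 + u + u ^+ 2 / 2 <= expR u.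
Proof.
move=> u0; rewrite -subr_ge0.
have := @ge0_derive_le (fun x => expR x - (1 + x + x ^+ 2 / 2))
  (fun x => expR x - (1 + x)) 0 u u0.
rewrite expR0 expr0n/= mul0r !addr0 subrr; apply.
- move=> x; apply: is_derive_eq; rewrite /GRing.scale/=; lra.
- by move=> x _; have := expR_ge1Dx x; lra.
Qed.

Lemma expRN_le u : 0 <= u -> expR (- u) <= 1 - u + u ^+ 2 / 2.
Proof.
move=> u0; rewrite -subr_ge0.
have := @ge0_derive_le (fun x => (1 - x + x ^+ 2 / 2) - expR (- x))
  (fun x => expR (- x) - (1 - x)) 0 u u0.
rewrite oppr0 expR0 expr0n/= mul0r !addr0 subrr; apply.
- move=> x; apply: is_derive_eq; rewrite /GRing.scale/=; lra.
- by move=> x _; have := expR_ge1Dx (- x); lra.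
Qed.

(** Multiplying the Bernstein bound
    [exp u - 1 - u <= u ^ 2 / (2 * (1 - u / 3))] by [1 - u / 3] makes it true
    for all [u >= 0]; it is then the Pade bound
    [(6 - 2 * u) * exp u <= u ^ 2 + 4 * u + 6]. *)
Lemma bernstein_expR u : 0 <= u ->
  (1 - u / 3) * (expR u - 1 - u) <= u ^+ 2 / 2.
Proof.
move=> u0.
have pade : 0 <= expR (- u) * (u ^+ 2 + 4 * u + 6) + (2 * u - 6).
  have := @ge0_derive_le
    (fun x => expR (- x) * (x ^+ 2 + 4 * x + 6) + (2 * x - 6))
    (fun x => 2 - expR (- x) * (x ^+ 2 + 2 * x + 2)) 0 u u0.
  rewrite oppr0 expR0 expr0n/= mul1r !mulr0 !add0r subrr; apply.
  - move=> x; apply: is_derive_eq; rewrite /GRing.scale/=; lra.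
  - move=> x /andP[x0 _]; have := expR_ge1DxD2 x0 => h.
    have e0 := expR_ge0 (- x).
    have e1 : expR (- x) * expR x = 1 by rewrite -expRD addNr expR0.
    have := ler_wpM2l e0 h; rewrite e1; lra.
have e1 : expR u * expR (- u) = 1 by rewrite -expRD addrN expR0.
have := mulr_ge0 (expR_ge0 u) pade; rewrite mulrDr mulrA e1 => h.
have -> : (1 - u / 3) * (expR u - 1 - u) =
  u ^+ 2 / 2 - (1 * (u ^+ 2 + 4 * u + 6) + expR u * (2 * u - 6)) / 6.
  by field.
lra.
Qed.

End exponential_inequalities.

Section size_bias_concentration.
Context d (T : measurableType d) (R : realType) (P : probability T R).
Variables (Z : T -> R) (C : R).
Hypotheses (C0 : 0 < C) (mZ : measurable_fun [set: T] Z)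
  (Z0 : forall w, 0 <= Z w).
Hypothesis intZ : forall th, P.-integrable [set: T]
  (EFin \o (fun w => expR (th * Z w))).

Let mean := \int[P]_w Z w.
Let mgf th := \int[P]_w expR (th * Z w).
Let tilted th := \int[P]_w (Z w * expR (th * Z w)).

(* The tail bounds only use the two comparisons below between the tilted mean
   and the moment generating function; they hold when a size-biased copy of Z
   can be coupled with Z so as to exceed it by at most C. *)
Hypothesis tilted_le : forall th, 0 <= th ->
  tilted th <= mean * expR (th * C) * mgf th.
Hypothesis tilted_ge : forall th, th <= 0 ->
  mean * expR (th * C) * mgf th <= tilted th.

Let mean_ge0 : 0 <= mean.
Proof. by apply: Rintegral_ge0. Qed.

Let Z_le_expR w : Z w <= expR (Z w).
Proof. by have := expR_ge1Dx (Z w); lra. Qed.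

(* The derivative is dominated near th by exp ((th + 2) * Z), one unit of the
   exponent being used to absorb the factor Z. *)
Let dmgf th : is_derive th (1 : R) mgf (tilted th).
Proof.
have D (x : R) w : is_derive x (1 : R) (fun y => expR (y * Z w)) (Z w * expR (x * Z w)).
  by apply: is_derive_eq; rewrite /GRing.scale/=; lra.
have dE x w : partial1of2 (fun x w => expR (x * Z w)) x w = Z w * expR (x * Z w).
  by rewrite partial1of2E; have [_ ->] := D x w.
have I : (`]th - 1, th + 1[%classic : set R) th by rewrite /= in_itv/=; apply/andP; split; lra.
have ub (x : R) w : `]th - 1, th + 1[%classic x -> [set: T] w ->
    `|partial1of2 (fun x w => expR (x * Z w)) x w| <= expR ((th + 2) * Z w).
  rewrite /= in_itv/= => /andP[x1 x2] _; rewrite dE ger0_norm; last first.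
    by rewrite mulr_ge0 ?expR_ge0.
  have -> : (th + 2) * Z w = Z w + (th + 1) * Z w by ring.
  rewrite expRD; apply: ler_pM; rewrite ?expR_ge0 ?Z_le_expR// ler_expR.
  by apply: ler_wpM2r => //; exact: ltW.
split.
  apply: (@derivable_under_integral _ _ _ P (fun x w => expR (x * Z w)) setT
    measurableT th (th - 1) (th + 1) I _ _ (fun w => expR ((th + 2) * Z w))) => //.
rewrite -derive1E.
rewrite (@differentiation_under_integral _ _ _ P (fun x w => expR (x * Z w)) setT
    measurableT th (th - 1) (th + 1) I _ _ (fun w => expR ((th + 2) * Z w)))//.
by apply: eq_Rintegral => w _; rewrite dE.
Qed.

(** The right-hand side is the moment generating function of [C] times a Poisson
    variable of mean [mean / C].  Its logarithmic derivative is
    [mean * exp (th * C)], which bounds that of [mgf] from above on the right of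
    [0] and from below on the left, and both functions are 1 at [0]. *)
Lemma mgf_le th : mgf th <= expR (mean * (expR (th * C) - 1) / C).
Proof.
pose g x := expR (- (mean * (expR (x * C) - 1) / C)).
pose dg x := - (mean * expR (x * C)) * g x.
have dgE (x : R) : is_derive x (1 : R) g (dg x).
  by rewrite /dg /g; apply: is_derive_eq; rewrite /GRing.scale/=; field; rewrite gt_eqF.
pose h x := mgf x * g x.
pose dh x := (tilted x - mean * expR (x * C) * mgf x) * g x.
have dhE (x : R) : is_derive x (1 : R) h (dh x).
  apply: (is_derive_eq (is_deriveM (dmgf x) (dgE x))).
  by rewrite /GRing.scale/= /dh /dg; ring.
have g0 x : 0 <= g x by rewrite /g expR_ge0.
have h0 : h 0 = 1.
  rewrite /h /g mul0r expR0 subrr mulr0 mul0r oppr0 expR0 mulr1 /mgf.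
  under eq_Rintegral do rewrite mul0r expR0.
  rewrite Rintegral_cst// mul1r; have /(congr1 fine) := probability_setT P.
  exact.
suff : h th <= h 0.
  by rewrite h0 /h /g expRN ler_pdivrMr ?expR_gt0// mul1r.
have [th0|/ltW th0] := leP 0 th.
  rewrite -lerN2; apply: (@ge0_derive_le _ (- h) (fun x => - dh x) 0 th th0).
  move=> x /andP[x0 _]; rewrite /= /dh oppr_ge0 mulr_le0_ge0// subr_le0.
  exact: tilted_le.
apply: (@ge0_derive_le _ h dh th 0 th0) => // x /andP[_ x0].
by rewrite /dh mulr_ge0// subr_ge0; exact: tilted_ge.
Qed.

Lemma exp_markov (A : set T) th a : measurable A ->
  (forall w, A w -> th * a <= th * Z w) ->
  (P A <= (expR (mean * (expR (th * C) - 1) / C - th * a))%:E)%E.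
Proof.
move=> mA AZ.
apply: (@le_trans _ _ (\int[P]_w (expR (th * Z w - th * a))%:E)%E).
  rewrite -(setIT A) -integral_indic//; apply: ge0_le_integral => //.
  - by apply/measurable_EFinP; exact: measurable_indic.
  - apply/measurable_EFinP; apply: measurableT_comp => //.
    by apply: measurable_funB => //; exact: measurable_funM.
  - move=> w _; rewrite lee_fin indicE; case: (boolP (w \in A)) => [|_] /=.
      rewrite inE => /AZ h; rewrite -expR0 ler_expR; lra.
    exact: expR_ge0.
under eq_integral do rewrite expRD EFinM muleC.
rewrite ge0_integralZl//=; last first.
  by apply/measurable_EFinP; apply: measurableT_comp => //; exact: measurable_funM.
have -> : (\int[P]_w (expR (th * Z w))%:E = (mgf th)%:E)%E.
  by rewrite /mgf /Rintegral fineK//; exact: integrable_fin_num (intZ th).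
by rewrite -EFinM lee_fin addrC expRD ler_wpM2l ?expR_ge0// mgf_le.
Qed.

(** The Chernoff parameter is [u / C] with [u = x / (mean + x / 3)], the choice
    for which the Bernstein bound on [exp u - 1 - u] gives back [u * x / 2]. *)
Lemma size_bias_upper x : 0 < x ->
  (P [set w | (mean + x < Z w)%R] <=
   (expR (- (x ^+ 2 / (2 * C * mean + 2 / 3 * C * x))))%:E)%E.
Proof.
move=> x0; have m0 := mean_ge0.
pose u := x / (mean + x / 3).
have D0 : 0 < mean + x / 3 by lra.
have u0 : 0 <= u by rewrite divr_ge0// ltW.
have mA : measurable [set w | (mean + x < Z w)%R].
  have := mZ measurableT (measurable_itv `]mean + x, +oo[); rewrite setTI.
  by congr measurable; apply/seteqP; split=> w /=; rewrite in_itv/= andbT.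
apply: (le_trans (@exp_markov _ (u / C) (mean + x) mA _)).
  move=> w /ltW /= h; apply: ler_wpM2l => //.
  by rewrite divr_ge0// ltW.
rewrite lee_fin ler_expR divfK ?gt_eqF//.
have mE : mean = (mean + x / 3) * (1 - u / 3).
  by rewrite /u; field; lra.
have xE : x = u * (mean + x / 3) by rewrite /u divfK// gt_eqF.
have -> : - (x ^+ 2 / (2 * C * mean + 2 / 3 * C * x)) =
  - (u * x / 2) / C.
  have : 0 < C * (mean + x / 3) by rewrite mulr_gt0.
  by rewrite /u => ?; field; rewrite !gt_eqF//=; lra.
clearbody u.
have := ler_wpM2l (ltW D0) (bernstein_expR u0); rewrite mulrA -mE => key.
have -> : mean * (expR u - 1) / C - u / C * (mean + x) =
  (mean * (expR u - 1 - u) - u * x) / C by field; rewrite gt_eqF.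
apply: ler_wpM2r; first by rewrite invr_ge0 ltW.
have : (mean + x / 3) * (u ^+ 2 / 2) = u * x / 2 by rewrite [in RHS]xE; ring.
lra.
Qed.

(** In the extended reals the bound is 0 when the mean is zero; the event is then
    empty. *)
Lemma size_bias_lower x : 0 < x ->
  (P [set w | (Z w < mean - x)%R] <=
   expeR (- ((x ^+ 2)%:E / (2 * C * mean)%:E)))%E.
Proof.
move=> x0; have := mean_ge0; rewrite le_eqVlt => /predU1P[m0|m0].
  rewrite (_ : [set w | _] = set0) ?measure0 ?expeR_ge0//.
  by apply/seteqP; split=> // w /=; rewrite -m0; have := Z0 w; lra.
have CM0 : 0 < 2 * C * mean by rewrite !mulr_gt0.
rewrite inver gt_eqF// -EFinM -EFinN /=.
pose u := x / mean.
have u0 : 0 <= u by rewrite divr_ge0// ltW.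
have mA : measurable [set w | (Z w < mean - x)%R].
  have := mZ measurableT (measurable_itv `]-oo, mean - x[); rewrite setTI.
  by congr measurable; apply/seteqP; split=> w /=; rewrite in_itv/=.
apply: (le_trans (@exp_markov _ (- (u / C)) (mean - x) mA _)).
  move=> w /ltW /= h; rewrite !mulNr lerN2; apply: ler_wpM2l => //.
  by rewrite divr_ge0// ltW.
rewrite lee_fin ler_expR mulNr divfK ?gt_eqF//.
have xE : x = u * mean by rewrite /u divfK// gt_eqF.
have -> : - (x ^+ 2 / (2 * C * mean)) = - (u * x / 2) / C.
  by rewrite /u; field; rewrite !gt_eqF.
clearbody u.
have := ler_wpM2l (ltW m0) (expRN_le u0) => key.
have -> : mean * (expR (- u) - 1) / C - - (u / C) * (mean - x) =
  (mean * (expR (- u) - 1 + u) - u * x) / C by field; rewrite gt_eqF.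
apply: ler_wpM2r; first by rewrite invr_ge0 ltW.
have : mean * (u ^+ 2 / 2) = u * x / 2 by rewrite [in RHS]xE; ring.
lra.
Qed.

End size_bias_concentration.

(** * Sums over countable types *)

Section countable_sums.
Local Open Scope ereal_scope.
Context {R : realType} {I : countType}.
Implicit Types a : I -> \bar R.

Lemma esum_countType a : (forall i, 0 <= a i) ->
  \esum_(i in [set: I]) a i = \sum_(n <oo) oapp a 0 (@pickle_inv I n).
Proof.
move=> a0; rewrite nneseries_esumT; last by move=> n; case: pickle_inv => /=.
transitivity (\esum_(n in range (@choice.pickle I)) oapp a 0 (@pickle_inv I n)).
  rewrite esum_image; first by apply: eq_esum => i _; rewrite pickleK_inv.
  by move=> x y _ _; exact: (pcan_inj pickleK_inv).
rewrite esum_mkcond; apply: eq_esum => n _; case: ifPn => // /negP nr.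
case e : (@pickle_inv I n) => [i|]//=; exfalso; apply: nr; rewrite inE.
by exists i => //; have := @pickle_invK I n; rewrite /ocancel e.
Qed.

Lemma esumZl (c : \bar R) (D : set I) a : 0 <= c -> (forall i, 0 <= a i) ->
  \esum_(i in D) (c * a i) = c * \esum_(i in D) a i.
Proof.
case: c => [c| |]//; rewrite ?lee_fin => c0 a0; last first.
  have [az|/existsNP[i /not_implyP[Di /eqP ai]]] := pselect (forall i, D i -> a i = 0).
    by rewrite !esum1 ?mule0// => i /az ->; rewrite mule0.
  have {}ai : 0 < a i by rewrite lt_neqAle eq_sym ai a0.
  have ge1 (b : I -> \bar R) : (forall i, 0 <= b i) -> b i <= \esum_(i in D) b i.
    move=> b0; apply: esum_ge; exists [set i]; last by rewrite fsbig_set1.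
    by split => // j ->.
  rewrite gt0_mulye; last exact: lt_le_trans (ge1 a a0).
  apply/eqP; rewrite -leye_eq; apply: le_trans (ge1 _ _).
    by rewrite gt0_mulye.
  by move=> j; rewrite mule_ge0.
rewrite esum_mkcond [in RHS]esum_mkcond !esum_countType; last 2 first.
- by move=> i; case: ifP.
- by move=> i; case: ifP => // _; rewrite mule_ge0.
rewrite -nneseriesZl//; last by move=> n _; case: pickle_inv => //= i; case: ifP.
apply: eq_eseriesr => n _; case: pickle_inv => /= [i|]; last by rewrite mule0.
by case: ifP; rewrite ?mule0.
Qed.

Lemma integral_esum d (T : measurableType d) (mu : {measure set T -> \bar R})
    (D : set T) (g : I -> T -> \bar R) : measurable D ->
  (forall i, measurable_fun D (g i)) -> (forall i x, D x -> 0 <= g i x) ->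
  \int[mu]_(x in D) (\esum_(i in [set: I]) g i x) =
  \esum_(i in [set: I]) \int[mu]_(x in D) g i x.
Proof.
move=> mD mg g0.
transitivity (\int[mu]_(x in D)
    (\sum_(n <oo) oapp (g ^~ x) 0 (@pickle_inv I n))).
  by apply: eq_integral => x /set_mem Dx; rewrite esum_countType// => i; exact: g0.
rewrite integral_nneseries//; last 2 first.
- by move=> n; case: pickle_inv.
- by move=> n x Dx; case: pickle_inv => //= i; exact: g0.
rewrite esum_countType; last by move=> i; apply: integral_ge0 => x; exact: g0.
by apply: eq_eseriesr => n _; case: pickle_inv => //=; rewrite integral0.
Qed.

End countable_sums.

Lemma esum_mul (R : realType) (I J : countType) (a : I -> \bar R)
    (b : J -> \bar R) : (forall i, 0 <= a i)%E -> (forall j, 0 <= b j)%E ->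
  (\esum_(i in [set: I]) \esum_(j in [set: J]) (a i * b j) =
   (\esum_(i in [set: I]) a i) * (\esum_(j in [set: J]) b j))%E.
Proof.
move=> a0 b0; under eq_esum => i _ do rewrite esumZl// muleC.
by rewrite esumZl ?esum_ge0// muleC.
Qed.

Lemma esum_exchange (R : realType) (I J : choiceType) (D : set I) (E : set J)
    (a : I -> J -> \bar R) : (forall i j, 0 <= a i j)%E ->
  (\esum_(i in D) \esum_(j in E) a i j = \esum_(j in E) \esum_(i in D) a i j)%E.
Proof.
move=> a0; rewrite !esum_esum//.
rewrite (reindex_esum (E `*` D) (D `*` E) (fun x => (x.2, x.1)))//; split=> //=.
- by move=> [i j] [/=].
- by move=> [i1 i2] [j1 j2] /= _ _ [] -> ->.
- by move=> [i1 i2] [Pi1 Qi2] /=; exists (i2, i1).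
Qed.

(** * Sums over finite samples *)

Section sample_sums.
Local Open Scope ereal_scope.
Context {R : realType} {F : countType} (m : F -> R).
Hypothesis m_ge0 : forall A, (0 <= m A)%R.
Implicit Types (D : set F) (G : seq F -> \bar R).

(** The integral of [G] over the [k]-th power of the measure with masses [m]
    restricted to [D]. *)
Fixpoint sample_sum D k G : \bar R :=
  if k is k'.+1 then
    \esum_(A in D) ((m A)%:E * sample_sum D k' (fun x => G (A :: x)))
  else G [::].

Lemma sample_sum_ge0 D k G : (forall x, 0 <= G x) -> 0 <= sample_sum D k G.
Proof.
elim: k G => [|k IH] G G0 //=.
by apply: esum_ge0 => A _; rewrite mule_ge0 ?lee_fin// IH.
Qed.

Lemma le_sample_sum D k G H :
  (forall x, 0 <= G x) ->
  (forall x, size x = k -> (forall A, A \in x -> D A /\ (0 < m A)%R) ->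
    G x <= H x) ->
  sample_sum D k G <= sample_sum D k H.
Proof.
elim: k G H => [|k IH] G H G0 GH /=; first by apply: GH => // A.
apply: le_esum => A DA.
have [mA|mA] := ltP 0%R (m A); last first.
  by have /eqP -> : m A == 0%R; rewrite ?mul0e// eq_le mA m_ge0.
apply: lee_wpmul2l; first by rewrite lee_fin ltW.
apply: IH => // x xk Dx; apply: GH => /=; first by rewrite xk.
by move=> B; rewrite inE => /predU1P[->//|]; exact: Dx.
Qed.

Lemma eq_sample_sum D k G H :
  (forall x, 0 <= G x) -> (forall x, 0 <= H x) ->
  (forall x, size x = k -> (forall A, A \in x -> D A /\ (0 < m A)%R) ->
    G x = H x) ->
  sample_sum D k G = sample_sum D k H.
Proof.
move=> G0 H0 GH; apply/eqP; rewrite eq_le !le_sample_sum// => x xk Dx.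
  by rewrite GH.
by rewrite GH.
Qed.

Lemma sample_sumZ D k (c : \bar R) G : 0 <= c -> (forall x, 0 <= G x) ->
  sample_sum D k (fun x => c * G x) = c * sample_sum D k G.
Proof.
move=> c0; elim: k G => [|k IH] G G0 //=.
rewrite -esumZl//; last by move=> A; rewrite mule_ge0 ?lee_fin ?sample_sum_ge0.
by apply: eq_esum => A _; rewrite IH// muleCA.
Qed.

Lemma sample_sum_exchange (J : countType) (w : J -> R) (E : set J) D k
    (H : J -> seq F -> \bar R) :
  (forall i, (0 <= w i)%R) -> (forall i x, 0 <= H i x) ->
  \esum_(i in E) ((w i)%:E * sample_sum D k (H i)) =
  sample_sum D k (fun x => \esum_(i in E) ((w i)%:E * H i x)).
Proof.
move=> w0; elim: k H => [|k IH] H H0 //=.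
have wE i : 0 <= (w i)%:E by rewrite lee_fin.
have mss i B : 0 <= (m B)%:E * sample_sum D k (fun x => H i (B :: x)).
  by rewrite mule_ge0 ?lee_fin ?sample_sum_ge0.
under eq_esum => i _ do rewrite -(esumZl _ (wE i) (mss i)).
rewrite esum_exchange//; last by move=> i B; rewrite mule_ge0 ?lee_fin.
apply: eq_esum => B _; rewrite -IH// -esumZl ?lee_fin//; last first.
  by move=> i; rewrite mule_ge0 ?lee_fin ?sample_sum_ge0.
by apply: eq_esum => i _; rewrite muleCA.
Qed.

Lemma sample_sum_cst D k (a : R) (c : \bar R) :
  \esum_(A in D) (m A)%:E = a%:E -> 0 <= c ->
  sample_sum D k (cst c) = (a ^+ k)%:E * c.
Proof.
move=> Da c0; have a0 : (0 <= a)%R.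
  by rewrite -lee_fin -Da esum_ge0// => A _; rewrite lee_fin.
elim: k => [|k IH] /=; first by rewrite expr0 mul1e.
rewrite [X in esum _ X](_ : _ = fun A => ((a ^+ k)%:E * c) * (m A)%:E); last first.
  by apply/funext => A; rewrite -IH muleC.
rewrite esumZl ?Da//; last by rewrite mule_ge0 ?lee_fin ?exprn_ge0.
by rewrite exprS EFinM muleC muleA.
Qed.

Lemma sample_sum_add D k l G : sample_sum D (k + l) G =
  sample_sum D k (fun u => sample_sum D l (fun v => G (u ++ v))).
Proof.
by elim: k G => [|k IH] G //=; apply: eq_esum => A _; rewrite IH.
Qed.

Section binomial.
Variables (D : set F).

(** The first [j] points range over [D], the other [l] over its complement. *)
Definition split_sum G j l :=
  sample_sum D j (fun u => sample_sum (~` D) l (fun v => G (u ++ v))).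

Lemma split_sum_ge0 G j l : (forall x, 0 <= G x) -> 0 <= split_sum G j l.
Proof. by move=> G0; do 2 apply: sample_sum_ge0 => ?. Qed.

Definition symmetric G := forall x y, perm_eq x y -> G x = G y.

(** A point of the complement that comes first may be moved behind the points of
    [D] because [G] is symmetric. *)
Lemma split_sum_rec G j l : (forall x, 0 <= G x) -> symmetric G ->
  \esum_(A in ~` D) ((m A)%:E * split_sum (fun x => G (A :: x)) j l) =
  split_sum G j l.+1.
Proof.
move=> G0 sG; rewrite /split_sum sample_sum_exchange//; last first.
  by move=> A x; exact: sample_sum_ge0.
congr sample_sum; apply/funext => u /=; apply: eq_esum => A _.
congr (_ * sample_sum _ _ _); apply/funext => v; apply: sG.
by rewrite perm_sym -cat1s perm_catCA.
Qed.

(** The binomial theorem for the sum of the restrictions of the measure to [D]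
    and to its complement: in an integral against its power, a symmetric
    function may have the points of [D] moved to the front. *)
Lemma sample_sum_binomial G k : (forall x, 0 <= G x) -> symmetric G ->
  sample_sum [set: F] k G =
  \sum_(j < k.+1) 'C(k, j)%:R%:E * split_sum G j (k - j).
Proof.
elim: k G => [|k IH] G G0 sG; first by rewrite big_ord1 bin0 subnn mul1e.
have mss A j l : 0 <= (m A)%:E * split_sum (fun x => G (A :: x)) j l.
  by rewrite mule_ge0 ?lee_fin ?split_sum_ge0.
have IH' E : \esum_(A in E) ((m A)%:E * sample_sum [set: F] k (fun x => G (A :: x))) =
    \sum_(j < k.+1) 'C(k, j)%:R%:E *
      \esum_(A in E) ((m A)%:E * split_sum (fun x => G (A :: x)) j (k - j)).
  under [RHS]eq_bigr do rewrite -esumZl//.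
  rewrite -esum_sum; last by move=> A j _ _; rewrite mule_ge0 ?lee_fin.
  apply: eq_esum => A _; rewrite IH//; last first.
    by move=> x y xy; apply: sG; rewrite perm_cons.
  rewrite ge0_sume_distrr; last first.
    by move=> j _; rewrite mule_ge0 ?lee_fin ?split_sum_ge0.
  by apply: eq_bigr => j _; rewrite muleCA.
rewrite /= (esumID D) ?setTI; last by move=> A _; rewrite mule_ge0 ?lee_fin ?sample_sum_ge0.
have -> : \esum_(A in ~` D) ((m A)%:E * sample_sum [set: F] k (fun x => G (A :: x))) =
    \sum_(j < k.+1) 'C(k, j)%:R%:E * split_sum G j (k - j).+1.
  by rewrite IH'; apply: eq_bigr => j _; rewrite split_sum_rec.
have -> : \esum_(A in D) ((m A)%:E * sample_sum [set: F] k (fun x => G (A :: x))) =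
    \sum_(j < k.+1) 'C(k, j)%:R%:E * split_sum G j.+1 (k - j).
  exact: IH'.
rewrite [X in _ + X]big_ord_recl [RHS]big_ord_recl /= !bin0 !subn0.
have -> : \sum_(i < k.+1) 'C(k.+1, bump 0 i)%:R%:E * split_sum G (bump 0 i) (k.+1 - bump 0 i) =
    \sum_(i < k.+1) 'C(k, i.+1)%:R%:E * split_sum G i.+1 (k - i) +
    \sum_(i < k.+1) 'C(k, i)%:R%:E * split_sum G i.+1 (k - i).
  rewrite -big_split; apply: eq_bigr => i _ /=.
  rewrite /bump add1n subSS binS natrD EFinD ge0_muleDl//.
rewrite addeCA; congr (_ + _); rewrite addeC; congr (_ + _).
rewrite big_ord_recr /= bin_small// mul0e adde0.
by apply: eq_bigr => i _; rewrite /bump add1n -subSn//.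
Qed.

End binomial.
End sample_sums.

(** * Poisson samples and thinning *)

Section chebyshev_sum.
Local Open Scope ereal_scope.
Context {R : realType} (p rho x : nat -> R) (Q S : R).
Hypotheses (p0 : forall i, (0 <= p i)%R) (rho0 : forall i, (0 <= rho i)%R)
  (x0 : forall i, (0 <= x i)%R)
  (rho_ni : forall i j, (i <= j)%N -> (rho j <= rho i)%R)
  (p1 : \esum_(i in [set: nat]) (p i)%:E = 1)
  (pQ : \esum_(i in [set: nat]) (p i * rho i)%:E = Q%:E)
  (pS : \esum_(i in [set: nat]) (p i * x i)%:E = S%:E).

Let prho0 i : 0 <= (p i * rho i)%:E. Proof. by rewrite lee_fin mulr_ge0. Qed.
Let px0 i : 0 <= (p i * x i)%:E. Proof. by rewrite lee_fin mulr_ge0. Qed.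
Let prx0 i : 0 <= (p i * rho i * x i)%:E.
Proof. by rewrite lee_fin !mulr_ge0. Qed.
Let pE i : 0 <= (p i)%:E. Proof. by rewrite lee_fin. Qed.

Let esum2D (a b : nat -> nat -> \bar R) :
  (forall i j, 0 <= a i j) -> (forall i j, 0 <= b i j) ->
  \esum_(i in [set: nat]) \esum_(j in [set: nat]) (a i j + b i j) =
  \esum_(i in [set: nat]) \esum_(j in [set: nat]) a i j +
  \esum_(i in [set: nat]) \esum_(j in [set: nat]) b i j.
Proof.
move=> a0 b0; rewrite -esumD; [|by move=> i _; exact: esum_ge0..].
by apply: eq_esum => i _; rewrite esumD.
Qed.

Let diag :
  \esum_(i in [set: nat]) \esum_(j in [set: nat])
    ((p i)%:E * (p j * rho j * x j)%:E + (p i * rho i * x i)%:E * (p j)%:E) =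
  2%:E * \esum_(i in [set: nat]) (p i * rho i * x i)%:E.
Proof.
rewrite esum2D; [|by move=> i j; rewrite mule_ge0..].
rewrite !esum_mul// p1 mul1e mule1.
by rewrite -[2%R]/(1 + 1)%R EFinD ge0_muleDl// mul1e.
Qed.

Let cross :
  \esum_(i in [set: nat]) \esum_(j in [set: nat])
    ((p i * rho i)%:E * (p j * x j)%:E + (p i * x i)%:E * (p j * rho j)%:E) =
  2%:E * (Q * S)%:E.
Proof.
rewrite esum2D; [|by move=> i j; rewrite mule_ge0..].
rewrite !esum_mul// pQ pS -!EFinM -EFinD; congr EFin; ring.
Qed.

(** Chebyshev's association inequality: sum
    [p i * p j * (rho i - rho j) * (x j - x i) >= 0] over all [i] and [j]. *)
Lemma chebyshev_sum_le : (forall i j, (i <= j)%N -> (x i <= x j)%R) ->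
  \esum_(i in [set: nat]) (p i * rho i * x i)%:E <= (Q * S)%:E.
Proof.
move=> xnd; rewrite -(@lee_pmul2l _ 2%:E)// -diag -cross.
apply: le_esum => i _; apply: le_esum => j _.
rewrite -!EFinM -!EFinD lee_fin -subr_ge0.
rewrite (_ : (_ - _)%R = ((p i * p j) * ((rho i - rho j) * (x j - x i)))%R);
  last by ring.
apply: mulr_ge0; [exact: mulr_ge0|]; have [ij|/ltnW ji] := leqP i j.
  by rewrite mulr_ge0// subr_ge0 ?rho_ni ?xnd.
by rewrite mulr_le0// subr_le0 ?rho_ni ?xnd.
Qed.

Lemma chebyshev_sum_ge : (forall i j, (i <= j)%N -> (x j <= x i)%R) ->
  (Q * S)%:E <= \esum_(i in [set: nat]) (p i * rho i * x i)%:E.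
Proof.
move=> xni; rewrite -(@lee_pmul2l _ 2%:E)// -diag -cross.
apply: le_esum => i _; apply: le_esum => j _.
rewrite -!EFinM -!EFinD lee_fin -subr_ge0.
rewrite (_ : (_ - _)%R = ((p i * p j) * ((rho i - rho j) * (x i - x j)))%R);
  last by ring.
apply: mulr_ge0; [exact: mulr_ge0|]; have [ij|/ltnW ji] := leqP i j.
  by rewrite mulr_ge0// subr_ge0 ?rho_ni ?xni.
by rewrite mulr_le0// subr_le0 ?rho_ni ?xni.
Qed.

End chebyshev_sum.

Section poisson_tilting.
Local Open Scope ereal_scope.
Context {R : realType} (lam : R) (k : nat) (g : nat -> \bar R) (S c : R).
Let p := @poisson_pmf R lam.
Let tail := \esum_(j in [set j | (k <= j)%N]) (p j)%:E.
Hypotheses (lam0 : (0 < lam)%R) (c0 : (0 <= c)%R) (g0 : forall j, 0 <= g j)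
  (pS : \esum_(j in [set: nat]) ((p j)%:E * g j) = S%:E).

Lemma poisson_pmf_gt0 j : (0 < p j)%R.
Proof.
by rewrite /p /poisson_pmf lam0 !mulr_gt0 ?expR_gt0 ?exprn_gt0 ?invr_gt0//
  ltr0n fact_gt0.
Qed.

Lemma esum_poisson_pmf : \esum_(j in [set: nat]) (p j)%:E = 1.
Proof.
have := probability_setT (poisson_prob lam 0).
by rewrite /= /poisson_prob lam0; apply.
Qed.

Let g_fin j : g j \is a fin_num.
Proof.
rewrite ge0_fin_numE//.
have h : (p j)%:E * g j < +oo.
  apply: (@le_lt_trans _ _ S%:E); last by rewrite ltry.
  rewrite -pS; apply: esum_ge; exists [set j]; last by rewrite fsbig_set1.
  by split.
move: h; case: (g j) => [r _|//|//]; first by rewrite ltry.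
by rewrite gt0_muley ?lte_fin ?poisson_pmf_gt0.
Qed.

(* Up to normalization, the density at j + k of the Poisson law conditioned to be
   at least k with respect to the law shifted by k. *)
Let rho j : R := (p (j + k) / p j)%R.

Let prho j : (p j * rho j = p (j + k))%R.
Proof. by rewrite /rho mulrC divfK// gt_eqF// poisson_pmf_gt0. Qed.

Let rhoE j : rho j = (lam ^+ k * ((j`!)%:R / ((j + k)`!)%:R))%R.
Proof.
rewrite /rho /p /poisson_pmf lam0 exprD; field.
by rewrite !gt_eqF ?expR_gt0 ?exprn_gt0 ?ltr0n ?fact_gt0.
Qed.

Let rho_ni i j : (i <= j)%N -> (rho j <= rho i)%R.
Proof.
move=> /subnKC <-; elim: (j - i)%N => [|n IH]; first by rewrite addn0.
rewrite addnS; apply: le_trans IH; rewrite !rhoE.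
set q := (i + n)%N; rewrite ler_pM2l ?exprn_gt0//.
rewrite ler_pdivrMr ?ltr0n ?fact_gt0// mulrAC ler_pdivlMr ?ltr0n ?fact_gt0//.
rewrite addSn !factS -!natrM ler_nat.
by rewrite mulnCA -mulnA leq_mul2r ltnS leq_addr orbT.
Qed.

Let esum_tail (h : nat -> \bar R) :
  \esum_(j in [set j | (k <= j)%N]) h j = \esum_(j in [set: nat]) h (j + k)%N.
Proof.
rewrite (reindex_esum [set: nat] _ (fun j => j + k)%N)//; split=> //=.
- by move=> j _ /=; rewrite leq_addl.
- by move=> i j _ _ /addIn.
- by move=> j kj; exists (j - k)%N => //; rewrite subnK.
Qed.

Let tail_fin : tail \is a fin_num.
Proof.
rewrite ge0_fin_numE; last by apply: esum_ge0 => j _; rewrite lee_fin ltW// poisson_pmf_gt0.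
apply: (@le_lt_trans _ _ 1); last by rewrite ltry.
rewrite -esum_poisson_pmf /tail esum_mkcond; apply: le_esum => j _.
by case: ifP => // _; rewrite lee_fin ltW// poisson_pmf_gt0.
Qed.

Let pQ : \esum_(j in [set: nat]) (p j * rho j)%:E = (fine tail)%:E.
Proof.
rewrite fineK// /tail esum_tail; apply: eq_esum => j _; by rewrite prho.
Qed.

Let p_ge0 j : (0 <= p j)%R. Proof. exact/ltW/poisson_pmf_gt0. Qed.

Let rho_ge0 j : (0 <= rho j)%R. Proof. by rewrite divr_ge0. Qed.

Let x j := fine (g (j + k)).

Let x_ge0 j : (0 <= x j)%R. Proof. by rewrite fine_ge0. Qed.

Let gE : \esum_(j in [set j | (k <= j)%N]) ((p j)%:E * g j) =
   \esum_(i in [set: nat]) (p i * rho i * x i)%:E.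
Proof.
rewrite esum_tail; apply: eq_esum => i _.
by rewrite prho EFinM fineK.
Qed.

Let pxE : \esum_(i in [set: nat]) (p i * x i)%:E =
  \esum_(j in [set: nat]) ((p j)%:E * g (j + k)%N).
Proof. by apply: eq_esum => i _; rewrite EFinM fineK. Qed.

Let g_homo (r : rel \bar R) : reflexive r -> transitive r ->
  (forall j, r (g j) (g j.+1)) -> forall i j, (i <= j)%N -> r (g i) (g j).
Proof.
move=> rr rt gr i j /subnKC <-; elim: (j - i)%N => [|n IH].
  by rewrite addn0.
by rewrite addnS; exact: rt IH (gr _).
Qed.

Let dominated_fin (h : nat -> \bar R) : (forall j, 0 <= h j) ->
  (exists C : R, (0 <= C)%R /\ forall j, h j <= C%:E * g j) ->
  \esum_(j in [set: nat]) ((p j)%:E * h j) \is a fin_num.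
Proof.
move=> h0 [C [C0 hC]]; have pE j : 0 <= (p j)%:E by rewrite lee_fin.
rewrite ge0_fin_numE; last by apply: esum_ge0 => j _; rewrite mule_ge0.
apply: (@le_lt_trans _ _ (C%:E * S%:E)); last by rewrite -EFinM ltry.
rewrite -pS -esumZl ?lee_fin//; last by move=> j; rewrite mule_ge0.
by apply: le_esum => j _; rewrite muleCA lee_wpmul2l.
Qed.

(** A Poisson variable conditioned to be at least [k] is stochastically smaller
    than its shift by [k], and the shift multiplies [g] by at most [c]. *)
Lemma poisson_tilting_le :
  (forall j, g j <= g j.+1) -> (forall j, g (j + k)%N <= c%:E * g j) ->
  \esum_(j in [set j | (k <= j)%N]) ((p j)%:E * g j) <= c%:E * tail * S%:E.
Proof.
move=> gnd gc; have pE j : 0 <= (p j)%:E by rewrite lee_fin.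
have fin : \esum_(j in [set: nat]) ((p j)%:E * g (j + k)%N) \is a fin_num.
  by apply: dominated_fin => //; exists c.
have pxS := pxE; rewrite -[RHS](fineK fin) in pxS.
rewrite gE; apply: (le_trans (chebyshev_sum_le p_ge0 rho_ge0 x_ge0 rho_ni
  esum_poisson_pmf pQ pxS _)).
  move=> i j ij; rewrite fine_le//.
  by apply: (@g_homo (fun a b => a <= b)) => //; [exact: le_trans|rewrite leq_add2r].
rewrite EFinM !fineK// muleAC muleC.
apply: lee_wpmul2r; first by apply: esum_ge0.
rewrite -pS -esumZl ?lee_fin//; last by move=> j; rewrite mule_ge0.
by apply: le_esum => j _; rewrite muleCA lee_wpmul2l.
Qed.

Lemma poisson_tilting_ge :
  (forall j, g j.+1 <= g j) -> (forall j, c%:E * g j <= g (j + k)%N) ->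
  c%:E * tail * S%:E <= \esum_(j in [set j | (k <= j)%N]) ((p j)%:E * g j).
Proof.
move=> gni gc; have pE j : 0 <= (p j)%:E by rewrite lee_fin.
have gni' i j : (i <= j)%N -> g j <= g i.
  by apply: (@g_homo (fun a b => b <= a)) => // y z w ? /le_trans; exact.
have fin : \esum_(j in [set: nat]) ((p j)%:E * g (j + k)%N) \is a fin_num.
  apply: dominated_fin => //; exists 1%R; split=> // j.
  by rewrite mul1e gni'// leq_addr.
have pxS := pxE; rewrite -[RHS](fineK fin) in pxS.
rewrite gE; apply: (le_trans _ (chebyshev_sum_ge p_ge0 rho_ge0 x_ge0 rho_ni
  esum_poisson_pmf pQ pxS _)); last first.
  by move=> i j ij; rewrite fine_le// gni'// leq_add2r.
rewrite EFinM !fineK// muleAC muleC.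
apply: lee_wpmul2l; first by apply: esum_ge0.
rewrite -pS -esumZl ?lee_fin//; last by move=> j; rewrite mule_ge0.
by apply: le_esum => j _; rewrite muleCA lee_wpmul2l.
Qed.

End poisson_tilting.

Section poisson_samples.
Local Open Scope ereal_scope.
Context {R : realType} {F : countType} (m : F -> R).
Hypotheses (m_ge0 : forall A, (0 <= m A)%R)
  (m1 : \esum_(A in [set: F]) (m A)%:E = 1).
Implicit Types (G : seq F -> \bar R).

(** The mean of [G] over a sample whose size is Poisson of parameter [t]. *)
Definition poisson_sum (t : R) G :=
  \esum_(k in [set: nat]) ((poisson_pmf t k)%:E * sample_sum m [set: F] k G).

Lemma poisson_sum_ge0 t G : (forall x, 0 <= G x) -> 0 <= poisson_sum t G.
Proof.
move=> G0; apply: esum_ge0 => k _.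
by rewrite mule_ge0 ?lee_fin ?poisson_pmf_ge0 ?sample_sum_ge0.
Qed.

Lemma le_poisson_sum t G H : (forall x, 0 <= G x) ->
  (forall x, (forall A, A \in x -> (0 < m A)%R) -> G x <= H x) ->
  poisson_sum t G <= poisson_sum t H.
Proof.
move=> G0 GH; apply: le_esum => k _.
rewrite lee_wpmul2l ?lee_fin ?poisson_pmf_ge0//; apply: le_sample_sum => //.
by move=> x _ xm; apply: GH => A /xm[].
Qed.

Lemma poisson_sum_cst1 t : (0 < t)%R -> poisson_sum t (cst 1) = 1.
Proof.
move=> t0; rewrite -[RHS](esum_poisson_pmf t0); apply: eq_esum => k _.
by rewrite (sample_sum_cst _ _ m1)// expr1n mul1e mule1.
Qed.

Lemma esum_diagonal (w : nat -> nat -> \bar R) : (forall j l, 0 <= w j l) ->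
  \esum_(k in [set: nat]) (\sum_(j < k.+1) w j (k - j)%N) =
  \esum_(j in [set: nat]) \esum_(l in [set: nat]) w j l.
Proof.
move=> w0.
have sE k : \sum_(j < k.+1) w j (k - j)%N = \esum_(j in `I_k.+1) w j (k - j)%N.
  by rewrite esum_fset// -fsbig_ord.
under eq_esum => k _ do rewrite sE.
rewrite !esum_esum//.
rewrite (reindex_esum ([set: nat] `*`` (fun=> [set: nat])) _
  (fun x => (x.1 + x.2, x.1)%N))/=.
  by apply: eq_esum => -[j l] _ /=; rewrite addKn.
split => /=.
- by move=> [j l] _ /=; split => //; rewrite ltnS leq_addr.
- by move=> [j l] [j' l'] _ _ [/= + jj]; rewrite jj => /addnI ->.
- move=> [k j] [_ /= jk]; exists (j, k - j)%N => //=.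
  by rewrite subnKC.
Qed.

Section thinning.
Variables (t : R) (D : pred F).
Hypothesis t0 : (0 < t)%R.
Let DS : set F := [set A | D A].
Definition thin_mass : R := fine (\esum_(A in DS) (m A)%:E).
Local Notation a := thin_mass.

Let mE A : 0 <= (m A)%:E. Proof. by rewrite lee_fin. Qed.

Lemma thin_massE : \esum_(A in DS) (m A)%:E = a%:E.
Proof.
rewrite fineK// ge0_fin_numE; last exact: esum_ge0.
apply: (@le_lt_trans _ _ 1); last by rewrite ltry.
rewrite -m1 esum_mkcond; apply: le_esum => A _; by case: ifP.
Qed.

Lemma thin_mass_ge0 : (0 <= a)%R.
Proof. by rewrite -lee_fin -thin_massE esum_ge0. Qed.

Let thin_massC : \esum_(A in ~` DS) (m A)%:E = (1 - a)%:E.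
Proof.
have := m1; rewrite (esumID DS)// !setTI thin_massE => h.
by rewrite EFinB -h addeAC subee ?add0e.
Qed.

Let w j l : R := (expR (- t) * (t ^+ j / j`!%:R) * (t ^+ l / l`!%:R))%R.

Let w_ge0 j l : (0 <= w j l)%R.
Proof. by rewrite /w !mulr_ge0 ?expR_ge0 ?invr_ge0 ?exprn_ge0// ltW. Qed.

(** Binomial coefficients times the Poisson weight of [k] split into products of
    weights of [j] and [k - j]. *)
Lemma poisson_split G : (forall x, 0 <= G x) -> symmetric G ->
  poisson_sum t G = \esum_(j in [set: nat]) \esum_(l in [set: nat])
    ((w j l)%:E * split_sum m DS G j l).
Proof.
move=> G0 sG.
rewrite -(@esum_diagonal (fun j l => (w j l)%:E * split_sum m DS G j l));
  last first.
  by move=> j l; rewrite mule_ge0 ?lee_fin ?split_sum_ge0.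
apply: eq_esum => k _; rewrite (sample_sum_binomial m_ge0 DS)//.
rewrite ge0_sume_distrr; last by move=> j _; rewrite mule_ge0 ?lee_fin ?split_sum_ge0.
apply: eq_bigr => j _; rewrite muleA -EFinM; congr (_%:E * _).
have jk : (j <= k)%N by rewrite -ltnS.
have tE : (t ^+ k = t ^+ j * t ^+ (k - j))%R by rewrite -exprD subnKC.
have bE : (k`!%:R = 'C(k, j)%:R * (j`!%:R * (k - j)`!%:R) :> R)%R.
  by rewrite -!natrM bin_fact.
rewrite /poisson_pmf t0 /w tE bE; field.
by rewrite !pnatr_eq0 -!lt0n !fact_gt0 bin_gt0.
Qed.

(** The Poisson weight of parameter [t * (1 - a)], except for the power of
    [1 - a], which [split_sum] contains. *)
Definition rest_weight l : R := (expR (- (t * (1 - a))) * (t ^+ l / l`!%:R))%R.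
Local Notation v := rest_weight.

Lemma rest_weight_ge0 l : (0 <= v l)%R.
Proof. by rewrite /v !mulr_ge0 ?expR_ge0 ?invr_ge0 ?exprn_ge0// ltW. Qed.

(** The integral of [G] given that the sample has [j] points in [D]. *)
Definition cond_sum G j := (a ^- j)%:E *
  \esum_(l in [set: nat])
    ((v l)%:E * split_sum m DS G j l).

Hypothesis a0 : (0 < a)%R.

Lemma cond_sum_ge0 G j : (forall x, 0 <= G x) -> 0 <= cond_sum G j.
Proof.
move=> G0; rewrite mule_ge0 ?lee_fin ?invr_ge0 ?exprn_ge0 ?thin_mass_ge0//.
by apply: esum_ge0 => l _; rewrite mule_ge0 ?lee_fin ?rest_weight_ge0 ?split_sum_ge0.
Qed.

(** The number of points in [D] is a Poisson variable of parameter [t * a], and the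
    rest of the sample is independent of it. *)
Lemma poisson_thinning G : (forall x, 0 <= G x) -> symmetric G ->
  poisson_sum t G =
  \esum_(j in [set: nat]) ((poisson_pmf (t * a) j)%:E * cond_sum G j).
Proof.
move=> G0 sG; rewrite poisson_split//; apply: eq_esum => j _.
rewrite /cond_sum muleA -EFinM -esumZl; last 2 first.
- by rewrite lee_fin mulr_ge0 ?poisson_pmf_ge0 ?invr_ge0 ?exprn_ge0 ?thin_mass_ge0.
- by move=> l; rewrite mule_ge0 ?lee_fin ?rest_weight_ge0 ?split_sum_ge0.
apply: eq_esum => l _; rewrite muleA -EFinM; congr (_%:E * _).
rewrite /w /v /poisson_pmf mulr_gt0//.
have -> : expR (- t) = (expR (- (t * a)) * expR (- (t * (1 - a))))%R.
  by rewrite -expRD; congr expR; ring.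
rewrite exprMn; field.
by rewrite !pnatr_eq0 -!lt0n !fact_gt0 expf_neq0 ?gt_eqF.
Qed.

Lemma le_cond_sum G H j : (forall x, 0 <= G x) ->
  (forall x, count D x = j -> (forall A, A \in x -> (0 < m A)%R) ->
    G x <= H x) ->
  cond_sum G j <= cond_sum H j.
Proof.
move=> G0 GH; rewrite lee_wpmul2l ?lee_fin ?invr_ge0 ?exprn_ge0 ?thin_mass_ge0//.
apply: le_esum => l _; rewrite lee_wpmul2l ?lee_fin ?rest_weight_ge0//.
apply: le_sample_sum => //; first by move=> u; exact: sample_sum_ge0.
move=> u uj Du; apply: le_sample_sum => // x xl Dx; apply: GH; last first.
  by move=> A; rewrite mem_cat => /orP[/Du[]|/Dx[]].
rewrite count_cat -uj; apply/eqP.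
have -> : count D u = size u.
  by apply/eqP; rewrite -all_count; apply/allP => A /Du[].
rewrite -[X in _ == X]addn0 eqn_add2l -leqn0 leqNgt -has_count.
by apply/hasPn => A /Dx[] /= /negP.
Qed.

Lemma cond_sumZ (c : R) G j : (0 <= c)%R -> (forall x, 0 <= G x) ->
  cond_sum (fun x => c%:E * G x) j = c%:E * cond_sum G j.
Proof.
move=> c0 G0; rewrite /cond_sum muleCA; congr (_ * _).
rewrite -esumZl ?lee_fin//; last first.
  by move=> l; rewrite mule_ge0 ?lee_fin ?rest_weight_ge0 ?split_sum_ge0.
apply: eq_esum => l _; rewrite [RHS]muleCA; congr (_ * _).
rewrite -sample_sumZ//; last by move=> u; exact: sample_sum_ge0.
by congr sample_sum; apply/funext => u; rewrite sample_sumZ.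
Qed.

(** The value does not depend on [j], and averages to 1 by thinning. *)
Lemma cond_sum_cst j : cond_sum (cst 1) j = 1.
Proof.
have E i : cond_sum (cst 1) i =
    \esum_(l in [set: nat]) ((v l)%:E * ((1 - a) ^+ l)%:E).
  rewrite /cond_sum -esumZl ?lee_fin ?invr_ge0 ?exprn_ge0 ?thin_mass_ge0//; last first.
    by move=> l; rewrite mule_ge0 ?lee_fin ?rest_weight_ge0 ?split_sum_ge0.
  apply: eq_esum => l _; rewrite /split_sum.
  rewrite [X in sample_sum _ _ _ X](_ : _ = cst ((1 - a) ^+ l)%:E); last first.
    by apply/funext => u; rewrite (sample_sum_cst _ _ thin_massC)// mule1.
  have al : 0 <= ((1 - a) ^+ l)%:E.
    by rewrite lee_fin exprn_ge0// -lee_fin -thin_massC esum_ge0.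
  rewrite (sample_sum_cst _ _ thin_massE)//.
  by rewrite -!EFinM; congr EFin; field; rewrite ?expf_neq0 ?gt_eqF.
have sc : symmetric (cst 1 : seq F -> \bar R) by [].
have := poisson_sum_cst1 t0; rewrite poisson_thinning//.
have <- : \esum_(i in [set: nat]) (cond_sum (cst 1) j * (poisson_pmf (t * a) i)%:E) =
  \esum_(i in [set: nat]) ((poisson_pmf (t * a) i)%:E * cond_sum (cst 1) i).
  by apply: eq_esum => i _; rewrite muleC !E.
rewrite esumZl ?cond_sum_ge0//; last by move=> i; rewrite lee_fin poisson_pmf_ge0.
by rewrite esum_poisson_pmf ?mulr_gt0// mule1.
Qed.

(** Having [k + j] points in [D] amounts to adding [k] independent points of [D] to
    a sample that has [j] of them; this compares [cond_sum] at [k + j] and [j]. *)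
Lemma cond_sum_shift G k j : (forall x, 0 <= G x) ->
  cond_sum G (k + j) = (a ^- k)%:E *
    sample_sum m DS k (fun u => cond_sum (fun x => G (u ++ x)) j).
Proof.
move=> G0; have aj : (0 <= a ^- j)%R by rewrite invr_ge0 exprn_ge0 ?thin_mass_ge0.
rewrite [X in _ = _ * X]sample_sumZ ?lee_fin//; last first.
  move=> u; apply: esum_ge0 => l _.
  by rewrite mule_ge0 ?lee_fin ?rest_weight_ge0 ?split_sum_ge0.
rewrite muleA -EFinM /cond_sum exprD invfM; congr (_ * _).
rewrite -sample_sum_exchange//; last 2 first.
- exact: rest_weight_ge0.
- by move=> l u; exact: split_sum_ge0.
apply: eq_esum => l _; congr (_ * _); rewrite /split_sum sample_sum_add.
congr sample_sum; apply/funext => u; congr sample_sum; apply/funext => u'.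
by congr sample_sum; apply/funext => x; rewrite catA.
Qed.

Let shift_const C k : 0 <= C -> C = (a ^- k)%:E * sample_sum m DS k (cst C).
Proof.
move=> C0; rewrite (sample_sum_cst _ _ thin_massE)// muleA -EFinM.
by rewrite mulVf ?mul1e ?expf_neq0 ?gt_eqF.
Qed.

Lemma cond_sum_shift_ge (c : R) G k j : (0 <= c)%R -> (forall x, 0 <= G x) ->
  (forall u x, size u = k -> (forall A, A \in u -> D A /\ (0 < m A)%R) ->
    (forall A, A \in x -> (0 < m A)%R) -> c%:E * G x <= G (u ++ x)) ->
  c%:E * cond_sum G j <= cond_sum G (k + j).
Proof.
move=> c0 G0 cG; have C0 : 0 <= c%:E * cond_sum G j.
  by rewrite mule_ge0 ?lee_fin ?cond_sum_ge0.
rewrite cond_sum_shift// [leLHS](shift_const k C0).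
rewrite lee_wpmul2l ?lee_fin ?invr_ge0 ?exprn_ge0 ?thin_mass_ge0//.
apply: le_sample_sum => // u uk Du; rewrite /cst -cond_sumZ//.
apply: le_cond_sum => [x|x _ mx]; first by rewrite mule_ge0 ?lee_fin.
exact: cG.
Qed.

Lemma cond_sum_shift_le (c : R) G k j : (0 <= c)%R -> (forall x, 0 <= G x) ->
  (forall u x, size u = k -> (forall A, A \in u -> D A /\ (0 < m A)%R) ->
    (forall A, A \in x -> (0 < m A)%R) -> G (u ++ x) <= c%:E * G x) ->
  cond_sum G (k + j) <= c%:E * cond_sum G j.
Proof.
move=> c0 G0 cG; have C0 : 0 <= c%:E * cond_sum G j.
  by rewrite mule_ge0 ?lee_fin ?cond_sum_ge0.
rewrite cond_sum_shift// [leRHS](shift_const k C0).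
rewrite lee_wpmul2l ?lee_fin ?invr_ge0 ?exprn_ge0 ?thin_mass_ge0//.
apply: le_sample_sum => [//|u|u uk Du]; first exact: cond_sum_ge0.
rewrite /cst -cond_sumZ//; apply: le_cond_sum => // x _ mx; exact: cG.
Qed.

Lemma cond_sum_count G k j : (forall x, 0 <= G x) ->
  cond_sum (fun x => (k <= count D x)%:R%:E * G x) j =
  (k <= j)%:R%:E * cond_sum G j.
Proof.
move=> G0; have H0 x (b : bool) : 0 <= b%:R%:E * G x.
  by rewrite mule_ge0 ?lee_fin.
by rewrite -cond_sumZ//; apply/eqP; rewrite eq_le; apply/andP; split;
  apply: le_cond_sum => // x ->.
Qed.

Lemma poisson_sum_count G k : (forall x, 0 <= G x) -> symmetric G ->
  poisson_sum t (fun x => (k <= count D x)%:R%:E * G x) =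
  \esum_(j in [set j | (k <= j)%N]) ((poisson_pmf (t * a) j)%:E * cond_sum G j).
Proof.
move=> G0 sG; rewrite poisson_thinning; last 2 first.
- by move=> x; rewrite mule_ge0 ?lee_fin.
- by move=> x y xy; rewrite (sG _ _ xy); move/permP : xy => ->.
rewrite [RHS]esum_mkcond; apply: eq_esum => j _; rewrite cond_sum_count//.
have -> : (j \in [set j | (k <= j)%N]) = (k <= j)%N by apply/idP/idP; rewrite inE.
by case: (k <= j)%N; rewrite ?mul1e// [X in _ * X]mul0e mule0.
Qed.

Lemma poisson_sum_tail k :
  poisson_sum t (fun x => (k <= count D x)%:R%:E) =
  \esum_(j in [set j | (k <= j)%N]) (poisson_pmf (t * a) j)%:E.
Proof.
have := @poisson_sum_count (cst 1) k; rewrite [X in poisson_sum t X](_ : _ =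
  (fun x => (k <= count D x)%:R%:E)); last by apply/funext => x; rewrite mule1.
by move=> ->//; apply: eq_esum => j _; rewrite cond_sum_cst mule1.
Qed.

End thinning.

Section size_bias.
Variables (t : R) (D : pred F) (k : nat) (h : seq F -> R) (c : R).
Hypotheses (t0 : (0 < t)%R) (k0 : (0 < k)%N) (c0 : (0 <= c)%R)
  (h0 : forall x, (0 <= h x)%R) (hsym : symmetric (EFin \o h))
  (hfin : poisson_sum t (EFin \o h) \is a fin_num).
Local Notation a := (thin_mass D).
Let good (u : seq F) := forall A, A \in u -> (0 < m A)%R.

Lemma poisson_sum_count0 G : (a <= 0)%R -> (forall x, 0 <= G x) ->
  poisson_sum t (fun x => (k <= count D x)%:R%:E * G x) = 0.
Proof.
move=> a0 G0; apply/eqP; rewrite eq_le poisson_sum_ge0 ?andbT; last first.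
  by move=> x; rewrite mule_ge0 ?lee_fin.
rewrite (_ : 0 = poisson_sum t (cst 0)); last first.
  rewrite /poisson_sum esum1// => l _.
  rewrite (_ : cst 0 = fun x => 0 * G x); last by apply/funext => x; rewrite mul0e.
  by rewrite sample_sumZ// mul0e mule0.
apply: le_poisson_sum => [x|x mx]; first by rewrite mule_ge0 ?lee_fin.
suff /negbTE -> : ~~ (k <= count D x)%N by rewrite [X in X <= _]mul0e.
rewrite -ltnNge; apply: leq_ltn_trans k0.
rewrite leqNgt -has_count; apply/hasPn => A Ax.
apply/negP => DA; have := mx _ Ax; rewrite ltNge => /negP; apply.
apply: le_trans a0; rewrite -lee_fin -thin_massE.
by apply: esum_ge; exists [set A]; [split=> // _ ->|rewrite fsbig_set1].
Qed.

(** The size-bias comparison for the event that at least [k] points fall in [D]: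
    conditioning on it costs no more than adding [k] points of [D]. *)
Lemma poisson_size_bias_le :
  (forall A x, D A -> h x <= h (A :: x))%R ->
  (forall u x, size u = k -> (forall A, A \in u -> D A) -> good u -> good x ->
    h (u ++ x) <= c * h x)%R ->
  poisson_sum t (fun x => (k <= count D x)%:R%:E * (h x)%:E) <=
  c%:E * poisson_sum t (fun x => (k <= count D x)%:R%:E) *
    poisson_sum t (EFin \o h).
Proof.
move=> hnd hc; have hE x : 0 <= (EFin \o h) x by rewrite lee_fin.
have [a0|a0] := leP a 0%R.
  rewrite poisson_sum_count0//.
  by rewrite !mule_ge0 ?lee_fin// poisson_sum_ge0.
rewrite (poisson_sum_count t0 a0 k hE hsym) poisson_sum_tail//.
rewrite -(fineK hfin); apply: poisson_tilting_le => //.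
- by rewrite mulr_gt0.
- by move=> j; exact: cond_sum_ge0.
- by rewrite fineK// (poisson_thinning t0 a0 hE hsym).
- move=> j; rewrite -[leLHS]mul1e -add1n; apply: cond_sum_shift_ge => //.
  move=> [|A [|//]] x //= _ /(_ A); rewrite mem_head => /(_ isT)[DA _] _.
  by rewrite mul1e lee_fin hnd.
- move=> j; rewrite addnC; apply: cond_sum_shift_le => // u x uk Du mx.
  rewrite -EFinM lee_fin; apply: hc => //; by move=> A /Du[].
Qed.

Lemma poisson_size_bias_ge :
  (forall A x, D A -> h (A :: x) <= h x)%R ->
  (forall u x, size u = k -> (forall A, A \in u -> D A) -> good u -> good x ->
    c * h x <= h (u ++ x))%R ->
  c%:E * poisson_sum t (fun x => (k <= count D x)%:R%:E) *
    poisson_sum t (EFin \o h) <=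
  poisson_sum t (fun x => (k <= count D x)%:R%:E * (h x)%:E).
Proof.
move=> hni hc; have hE x : 0 <= (EFin \o h) x by rewrite lee_fin.
have [a0|a0] := leP a 0%R.
  have := @poisson_sum_count0 (cst 1) a0; under eq_fun do rewrite mule1.
  by move=> ->//; rewrite mule0 mul0e poisson_sum_ge0// => x; rewrite mule_ge0 ?lee_fin.
rewrite (poisson_sum_count t0 a0 k hE hsym) poisson_sum_tail//.
rewrite -(fineK hfin); apply: poisson_tilting_ge => //.
- by rewrite mulr_gt0.
- by move=> j; exact: cond_sum_ge0.
- by rewrite fineK// (poisson_thinning t0 a0 hE hsym).
- move=> j; rewrite -[leRHS]mul1e -add1n; apply: cond_sum_shift_le => //.
  move=> [|A [|//]] x //= _ /(_ A); rewrite mem_head => /(_ isT)[DA _] _.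
  by rewrite mul1e lee_fin hni.
- move=> j; rewrite addnC; apply: cond_sum_shift_ge => // u x uk Du mx.
  rewrite -EFinM lee_fin; apply: hc => //; by move=> A /Du[].
Qed.

End size_bias.

End poisson_samples.

(** * Species in a finite sample of sets *)

Section species_counts.
Context {S : countType}.
Implicit Types (s : S) (x u v : seq {fset S}) (A : {fset S}).

Definition occurrences s x : nat := count (fun A => s \in A) x.

Definition species k x : nat :=
  num_species [set s | (k <= occurrences s x)%N].

Definition seq_fsetU x : {fset S} := foldr (fun A U => A `|` U)%fset fset0 x.

Lemma occurrences_gt0 s x : (0 < occurrences s x)%N = (s \in seq_fsetU x).
Proof.
rewrite /occurrences; elim: x => [|A x IH] //=.
by rewrite inE -IH; case: (s \in A).
Qed.

Lemma finite_species k x : (0 < k)%N ->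
  finite_set [set s | (k <= occurrences s x)%N].
Proof.
move=> k0; apply: (@sub_finite_set _ _ [set` seq_fsetU x]) => [s /=|].
  by move=> /(leq_trans k0); rewrite occurrences_gt0.
exact: finite_fset.
Qed.

Lemma le_num_species (A B : set S) : finite_set B -> A `<=` B ->
  (num_species A <= num_species B)%N.
Proof.
move=> fB AB; apply: fsubset_leq_card.
by rewrite -fset_set_sub//; exact: sub_finite_set fB.
Qed.

Lemma species_perm k x y : perm_eq x y -> species k x = species k y.
Proof.
move=> /permP xy; congr num_species; apply/seteqP.
by split => s /=; rewrite /occurrences xy.
Qed.

Lemma species_cons k A x : (0 < k)%N -> (species k x <= species k (A :: x))%N.
Proof.
move=> k0; apply: le_num_species; first exact: finite_species.
by move=> s /= /leq_trans; apply; rewrite /occurrences /= leq_addl.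
Qed.

Lemma species_cat_le k u x : (0 < k)%N ->
  (species k (u ++ x) <= species k x + #|` seq_fsetU u|)%N.
Proof.
move=> k0; have fx := finite_species x k0.
apply: (@leq_trans (num_species ([set s | (k <= occurrences s x)%N] `|`
  [set` seq_fsetU u]))).
  apply: le_num_species; first by rewrite finite_setU; split.
  move=> s /=; rewrite /occurrences count_cat.
  have [|] := boolP (s \in seq_fsetU u); first by right.
  by rewrite -occurrences_gt0 -leqNgt leqn0 /occurrences => /eqP -> ; left.
rewrite /num_species fset_setU// set_fsetK cardfsU.
exact: leq_subr.
Qed.

Lemma card_seq_fsetU B x : {in x, forall A, #|` A| <= B}%N ->
  (#|` seq_fsetU x| <= B * size x)%N.
Proof.
elim: x => [|A x IH] xB; first by rewrite [seq_fsetU _]/= cardfs0.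
rewrite [seq_fsetU _]/= [size _]/=.
rewrite mulnS cardfsU; apply: leq_trans (leq_subr _ _) _.
rewrite leq_add ?xB ?mem_head// IH// => A' A'x.
by rewrite xB// inE A'x orbT.
Qed.

(** Sets with a common element have a smaller union, whence the constant
    [2 * B - 1] for two sets. *)
Lemma card_seq_fsetU_common B s x : {in x, forall A, #|` A| <= B}%N ->
  {in x, forall A, s \in A} -> (#|` seq_fsetU x| <= 1 + size x * B.-1)%N.
Proof.
move=> xB xs.
suff : (#|` s |` seq_fsetU x| <= 1 + size x * B.-1)%fset%N.
  by apply: leq_trans; apply: fsubset_leq_card; exact: fsubsetUr.
elim: x xB xs => [|A x IH] xB xs /=; first by rewrite fsetU0 cardfs1.
have {}IH : (#|` s |` seq_fsetU x| <= 1 + size x * B.-1)%fset%N.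
  by apply: IH => A' A'x; [apply: xB|apply: xs]; rewrite inE A'x orbT.
have -> : (s |` (A `|` seq_fsetU x) = (s |` seq_fsetU x) `|` (A `\ s))%fset.
  by apply/fsetP => s'; rewrite !inE; case: (s' == s); case: (s' \in A) => /=;
    rewrite ?orbT ?orbF.
rewrite cardfsU; apply: leq_trans (leq_subr _ _) _.
rewrite mulSn addnCA addnC leq_add//.
have := xB A (mem_head _ _); rewrite (cardfsD1 s) xs ?mem_head//.
by rewrite add1n; case: B {xB IH} => [|B].
Qed.

Lemma species_size B k x : (0 < k)%N -> {in x, forall A, #|` A| <= B}%N ->
  (species k x <= B * size x)%N.
Proof.
move=> k0 xB; apply: leq_trans (card_seq_fsetU xB).
rewrite -(cats0 x); apply: leq_trans (species_cat_le _ _ k0) _.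
rewrite cats0 -[leqRHS]add0n leq_add2r /species.
rewrite (_ : [set _ | _] = set0) /num_species ?fset_set0 ?cardfs0//.
by apply/seteqP; split => s //=; rewrite leqNgt k0.
Qed.

Lemma species_esum (R : realType) k x : (0 < k)%N ->
  ((species k x)%:R%:E =
   \esum_(s in [set: S]) (k <= occurrences s x)%N%:R%:E :> \bar R)%E.
Proof.
move=> k0; have fx := finite_species x k0.
transitivity (\esum_(s in [set s | (k <= occurrences s x)%N]) (1%:E : \bar R))%E.
  rewrite esum_fset// fsbig_finite//= sumEFin big_const_seq count_predT iter_addr.
  by rewrite addr0 /species /num_species cardfE cardE.
rewrite [LHS]esum_mkcond; apply: eq_esum => s _.
have -> : (s \in [set s | (k <= occurrences s x)%N]) = (k <= occurrences s x)%N.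
  by apply/idP/idP; rewrite inE.
by case: (k <= _)%N.
Qed.

End species_counts.

(** * Concentration of species counts in a Poisson sample *)

(** Every function of a countably valued variable with measurable fibers is
    measurable, and its integral is a sum over the values; this reduces the
    probability space to sums over finite samples. *)
Section countable_valued.
Context d (T : measurableType d) (R : realType) (C : countType) (Y : T -> C).
Hypothesis mY : forall x, measurable (Y @^-1` [set x]).

Lemma measurable_countable_valued d' (T' : measurableType d') (phi : C -> T') :
  measurable_fun [set: T] (phi \o Y).
Proof.
move=> _ B _; rewrite setTI.
have -> : (phi \o Y) @^-1` B = \bigcup_(n in [set: nat])
    (if pickle_inv n is Some x then
       (if phi x \in B then Y @^-1` [set x] else set0) else set0).
  apply/seteqP; split => [w /= Bw|w [n _]].
    by exists (choice.pickle (Y w)); rewrite // pickleK_inv mem_set.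
  case: pickle_inv => // x; case: ifPn => //; rewrite inE => Bx /= Yw.
  by rewrite /preimage/= Yw.
by apply: bigcup_measurable => n _; case: pickle_inv => // x; case: ifP.
Qed.

Lemma integral_countable_valued (mu : {measure set T -> \bar R})
    (G : C -> \bar R) : (forall x, 0 <= G x)%E ->
  (\int[mu]_w G (Y w) =
   \esum_(x in [set: C]) (G x * mu (Y @^-1` [set x])))%E.
Proof.
move=> G0; pose g x w := (G x * (\1_(Y @^-1` [set x]) w)%:E)%E.
have g0 x w : (0 <= g x w)%E by rewrite mule_ge0 ?lee_fin.
have mg x : measurable_fun [set: T] (EFin \o (\1_(Y @^-1` [set x]) : T -> R)).
  by apply/measurable_EFinP; exact: measurable_indic.
transitivity (\int[mu]_w \esum_(x in [set: C]) g x w)%E.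
  apply: eq_integral => w _; rewrite (esumID [set Y w])// setTI.
  rewrite esum_set1// [X in (_ + X)%E]esum1 ?adde0.
    by rewrite /g indicE mem_set// mule1.
  by move=> x [_ xY]; rewrite /g indicE memNset ?mule0// => Yx; exact: xY.
rewrite integral_esum//; last by move=> x; apply: measurable_funeM; exact: mg.
apply: eq_esum => x _; rewrite ge0_integralZl//; last exact: mg.
by rewrite integral_indic ?setIT.
Qed.

End countable_valued.

Section poisson_law.
Context d (Omega : measurableType d) (R : realType) (P : probability Omega R)
  (S : countType) (mu : probability {fset S} R).

Definition mass (A : {fset S}) : R := fine (mu [set A]).

Lemma massE A : (mass A)%:E = mu [set A].
Proof. by rewrite fineK// fin_num_measure. Qed.

Lemma mass_ge0 A : 0 <= mass A.
Proof. by rewrite fine_ge0. Qed.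

Lemma mass1 : (\esum_(A in [set: {fset S}]) (mass A)%:E = 1)%E.
Proof.
rewrite -(probability_setT mu).
have := @integral_countable_valued _ {fset S} R {fset S} id _ mu (cst 1%E).
rewrite integral_cst// mul1e => ->//.
by apply: eq_esum => A _; rewrite mul1e massE.
Qed.

Definition poisson_sample (lam : R) (Y : Omega -> seq {fset S}) : Prop :=
  (forall x, measurable (Y @^-1` [set x])) /\
  (forall x, P (Y @^-1` [set x]) =
    ((poisson_pmf lam (size x))%:E * \prod_(A <- x) mu [set A])%E).

Lemma sample_sum_esum k (G : seq {fset S} -> \bar R) : (forall x, 0 <= G x)%E ->
  (sample_sum mass [set: {fset S}] k G =
   \esum_(x in [set x | size x = k]) (G x * (\prod_(A <- x) mu [set A])))%E.
Proof.
have p0 (x : seq {fset S}) : (0 <= \prod_(A <- x) mu [set A])%E by exact: prode_ge0.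
elim: k G => [|k IH] G G0 /=.
  rewrite (_ : [set x | _] = [set [::]]); last first.
    by apply/seteqP; split => x /=; [move/size0nil|move=> ->].
  by rewrite esum_set1 big_nil mule1.
transitivity (\esum_(A in [set: {fset S}]) \esum_(x in [set x | size x = k])
    (G (A :: x) * \prod_(A' <- A :: x) mu [set A']))%E.
  apply: eq_esum => A _; rewrite IH// -esumZl ?lee_fin ?mass_ge0//; last first.
    by move=> x; rewrite mule_ge0.
  by apply: eq_esum => x _; rewrite big_cons massE muleCA.
rewrite esum_esum; last by move=> *; rewrite mule_ge0.
rewrite [RHS](reindex_esum ([set: {fset S}] `*`` (fun=> [set x | size x = k])) _
  (fun a => a.1 :: a.2))//; split => /=.
- by move=> [A x] [_ /= ->].
- by move=> [A x] [A' x'] _ _ /= [-> ->].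
- by move=> [//|A x] /= [xk]; exists (A, x).
Qed.

Variables (lam : R) (Y : Omega -> seq {fset S}).
Hypotheses (lam0 : 0 < lam) (hY : poisson_sample lam Y).
Let mY := hY.1.

(** Both sides sum over the finite sequences of sets, grouped by size on the
    right. *)
Lemma expectation_poisson_sample (G : seq {fset S} -> \bar R) :
  (forall x, 0 <= G x)%E ->
  (\int[P]_w G (Y w) = poisson_sum mass lam G)%E.
Proof.
have p0 (x : seq {fset S}) : (0 <= \prod_(A <- x) mu [set A])%E by exact: prode_ge0.
move=> G0; rewrite (integral_countable_valued mY)// /poisson_sum.
have pp k : (0 <= (poisson_pmf lam k)%:E)%E by rewrite lee_fin poisson_pmf_ge0.
transitivity (\esum_(k in [set: nat]) \esum_(x in [set x : seq {fset S} | size x = k])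
  ((poisson_pmf lam k)%:E * (G x * \prod_(A <- x) mu [set A])))%E.
  rewrite esum_esum; last by move=> *; rewrite !mule_ge0.
  rewrite (reindex_esum [set: seq {fset S}] _ (fun x => (size x, x)))//=.
    by apply: eq_esum => x _; rewrite hY.2 muleCA.
  split => //=; first by move=> x y _ _ [].
  by move=> [k x] [_ /= xk]; exists x => //; rewrite xk.
apply: eq_esum => k _; rewrite sample_sum_esum// esumZl//.
by move=> x; rewrite mule_ge0.
Qed.

Variables (B k : nat).
Hypotheses (hmu : size_bounded mu B) (k0 : (0 < k)%N).

Lemma mass_gt0_size A : 0 < mass A -> (#|` A| <= B)%N.
Proof.
move=> mA; rewrite leqNgt; apply/negP => /hmu h.
by move: mA; rewrite /mass h ltxx.
Qed.

Definition species_count w : R := (species k (Y w))%:R.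
Local Notation Z := species_count.

Lemma measurable_species_count : measurable_fun [set: Omega] Z.
Proof.
exact: (@measurable_countable_valued _ _ _ _ mY _ _
  (fun x => (species k x)%:R : R)).
Qed.

Let measurable_exp th : measurable_fun [set: Omega] (fun w => expR (th * Z w)).
Proof.
apply: measurableT_comp => //; apply: measurable_funM => //.
exact: measurable_species_count.
Qed.

Let tilt th (x : seq {fset S}) : R := expR (th * (species k x)%:R).

Let tilt_ge0 th x : (0 <= (EFin \o tilt th) x)%E.
Proof. by rewrite lee_fin expR_ge0. Qed.

(** Exponential moments are finite because a sample of [k] sets shows at most
    [B * k] species and a Poisson variable has exponential moments. *)
Lemma poisson_sum_expR (q : R) : 0 <= q ->
  (poisson_sum mass lam (fun x => (expR (q * (B * size x)%:R))%:E) < +oo)%E.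
Proof.
move=> q0; pose Q := expR (q * B%:R).
have lQ : 0 < lam * Q by rewrite mulr_gt0 ?expR_gt0.
rewrite (_ : poisson_sum _ _ _ = (expR (lam * Q - lam))%:E *
  \esum_(j in [set: nat]) (poisson_pmf (lam * Q) j)%:E)%E.
  by rewrite esum_poisson_pmf// mule1 ltry.
rewrite -esumZl ?lee_fin ?expR_ge0//; last first.
  by move=> j; rewrite lee_fin poisson_pmf_ge0.
apply: eq_esum => j _.
rewrite (@eq_sample_sum _ _ _ mass_ge0 _ _ _ (cst (Q ^+ j)%:E)); last 3 first.
- by move=> x; rewrite lee_fin expR_ge0.
- by move=> x; rewrite lee_fin exprn_ge0 ?expR_ge0.
- by move=> x xj _; rewrite xj natrM mulrA expRM_natr.
rewrite (sample_sum_cst mass_ge0 _ mass1) ?lee_fin ?exprn_ge0 ?expR_ge0//.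
rewrite expr1n mul1e -!EFinM; congr EFin.
rewrite /poisson_pmf lam0 lQ exprMn addrC expRD.
have -> : expR (- (lam * Q)) = (expR (lam * Q))^-1 by rewrite expRN.
by field; rewrite !pnatr_eq0 -!lt0n fact_gt0 gt_eqF ?expR_gt0.
Qed.

Lemma tilt_fin th : poisson_sum mass lam (EFin \o tilt th) \is a fin_num.
Proof.
rewrite ge0_fin_numE; last by rewrite poisson_sum_ge0//; exact: mass_ge0.
apply: le_lt_trans (poisson_sum_expR (normr_ge0 th)).
apply: le_poisson_sum => // [|x mx]; first exact: mass_ge0.
rewrite lee_fin ler_expR; apply: (@le_trans _ _ (`|th| * (species k x)%:R)).
  by rewrite ler_wpM2r// ler_norm.
rewrite ler_wpM2l// ler_nat; apply: species_size => // A Ax.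
by apply: mass_gt0_size; exact: mx.
Qed.

Lemma integrable_exp_species th :
  P.-integrable [set: Omega] (EFin \o (fun w => expR (th * Z w))).
Proof.
apply/integrableP; split; first exact/measurable_EFinP/measurable_exp.
under eq_integral do rewrite /= ger0_norm ?expR_ge0//.
rewrite (expectation_poisson_sample (tilt_ge0 th)).
by rewrite -ge0_fin_numE ?tilt_fin// poisson_sum_ge0//; exact: mass_ge0.
Qed.

Lemma integrable_species : P.-integrable [set: Omega] (EFin \o Z).
Proof.
apply: le_integrable (integrable_exp_species 1) => //.
  by apply/measurable_EFinP; exact: measurable_species_count.
move=> w _ /=; rewrite mul1r lee_fin !ger0_norm ?expR_ge0//.
by have := expR_ge1Dx (Z w); lra.
Qed.

Let occ s (x : seq {fset S}) : \bar R := (k <= occurrences s x)%N%:R%:E.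

(* The count is the sum over the species s of the indicators that s occurs at
   least k times; each of them is treated by a size-bias comparison. *)
Let integral_by_species (h : seq {fset S} -> R) : (forall x, 0 <= h x) ->
  (\int[P]_w (Z w * h (Y w))%:E =
   \esum_(s in [set: S]) poisson_sum mass lam (fun x => occ s x * (h x)%:E))%E.
Proof.
move=> h0; have hE x : (0 <= (h x)%:E)%E by rewrite lee_fin.
have oE s x : (0 <= occ s x)%E by rewrite lee_fin.
under eq_integral do rewrite EFinM (species_esum R _ k0) muleC -esumZl//.
rewrite integral_esum//; last 2 first.
- move=> s; exact: (@measurable_countable_valued _ _ _ _ mY _ _
    (fun x => (h x)%:E * occ s x)%E).
- by move=> s w _; rewrite mule_ge0.
apply: eq_esum => s _; rewrite -expectation_poisson_sample//; last first.
  by move=> x; rewrite mule_ge0.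
by apply: eq_integral => w _; rewrite muleC.
Qed.

Lemma species_mean_esum :
  ((\int[P]_w Z w)%:E =
   \esum_(s in [set: S]) poisson_sum mass lam
     (fun x => (k <= occurrences s x)%N%:R%:E))%E.
Proof.
rewrite /Rintegral fineK; last exact: integrable_fin_num integrable_species.
under eq_integral do rewrite -[Z _]mulr1.
rewrite (integral_by_species (h := cst 1))//; apply: eq_esum => s _.
by congr poisson_sum; apply/funext => x; rewrite mule1.
Qed.

(** The size of the union of [k] sets of size [B] that pairwise meet in one common
    element: a bound on the increase of the species count when [k] sets with a
    common element are added. *)
Definition jump : nat := (1 + k * B.-1)%N.

Let species_jump (u x : seq {fset S}) s : size u = k -> (forall A, A \in u -> s \in A) ->
  (forall A, A \in u -> 0 < mass A) ->
  (species k (u ++ x) <= species k x + jump)%N.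
Proof.
move=> uk us um; apply: leq_trans (species_cat_le _ _ k0) _.
rewrite leq_add2l /jump -uk; apply: card_seq_fsetU_common (us) => A /um.
exact: mass_gt0_size.
Qed.

Let mgf th := \int[P]_w expR (th * Z w).

Let mgfE th : (mgf th)%:E = poisson_sum mass lam (EFin \o tilt th).
Proof.
rewrite /mgf /Rintegral fineK; last exact: integrable_fin_num (integrable_exp_species th).
by rewrite -expectation_poisson_sample.
Qed.

Let tilted_integrable th :
  (\int[P]_w (Z w * expR (th * Z w))%:E)%E \is a fin_num.
Proof.
apply: integrable_fin_num => //.
apply: le_integrable (integrable_exp_species (1 + th)) => //.
  apply/measurable_EFinP; apply: measurable_funM; last exact: measurable_exp.
  exact: measurable_species_count.
move=> w _ /=; rewrite lee_fin !ger0_norm ?expR_ge0 ?mulr_ge0 ?expR_ge0//.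
rewrite mulrDl mul1r expRD ler_wpM2r ?expR_ge0//.
by have := expR_ge1Dx (Z w); lra.
Qed.

Let tilt_sym th : symmetric (EFin \o tilt th).
Proof. by move=> x y xy; rewrite /= /tilt (species_perm k xy). Qed.

Let bound_esum (c M : R) : 0 <= c -> 0 <= M ->
  (\esum_(s in [set: S]) (c%:E * poisson_sum mass lam (occ s) * M%:E) =
   c%:E * (\int[P]_w Z w)%:E * M%:E)%E.
Proof.
move=> c0 M0; rewrite species_mean_esum muleAC -esumZl; last 2 first.
- by rewrite mule_ge0 ?lee_fin.
- by move=> s; rewrite poisson_sum_ge0//; exact: mass_ge0.
by apply: eq_esum => s _; rewrite muleAC.
Qed.

Let mgf_ge0 th : 0 <= mgf th.
Proof. by apply: Rintegral_ge0 => w _; exact: expR_ge0. Qed.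

(** The size-bias comparison is applied to each species [s], with [D] the sets that
    contain [s], and summed over [s]. *)
Lemma species_tilted_le th : 0 <= th ->
  \int[P]_w (Z w * expR (th * Z w)) <=
  (\int[P]_w Z w) * expR (th * jump%:R) * mgf th.
Proof.
move=> th0; rewrite -lee_fin [in leLHS]/Rintegral fineK ?tilted_integrable//.
rewrite (integral_by_species (h := tilt th)); last by move=> x; exact: expR_ge0.
rewrite [X in X * mgf th]mulrC 2!EFinM -bound_esum ?expR_ge0//.
apply: le_esum => s _; rewrite mgfE.
apply: (poisson_size_bias_le mass_ge0 mass1 lam0 k0) => //.
- by move=> x; exact: expR_ge0.
- exact: tilt_fin.
- move=> A x _; rewrite ler_expR ler_wpM2l// ler_nat.
  exact: species_cons.
- move=> u x uk us um _; rewrite -expRD ler_expR -mulrDr ler_wpM2l//.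
  by rewrite addrC -natrD ler_nat; exact: species_jump us um.
Qed.

Lemma species_tilted_ge th : th <= 0 ->
  (\int[P]_w Z w) * expR (th * jump%:R) * mgf th <=
  \int[P]_w (Z w * expR (th * Z w)).
Proof.
move=> th0; rewrite -lee_fin [in leRHS]/Rintegral fineK ?tilted_integrable//.
rewrite (integral_by_species (h := tilt th)); last by move=> x; exact: expR_ge0.
rewrite [X in X * mgf th]mulrC 2!EFinM -bound_esum ?expR_ge0//.
apply: le_esum => s _; rewrite mgfE.
apply: (poisson_size_bias_ge mass_ge0 mass1 lam0 k0) => //.
- by move=> x; exact: expR_ge0.
- exact: tilt_fin.
- move=> A x _; rewrite ler_expR ler_wnM2l// ler_nat.
  exact: species_cons.
- move=> u x uk us um _; rewrite -expRD ler_expR -mulrDr ler_wnM2l//.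
  by rewrite addrC -natrD ler_nat; exact: species_jump us um.
Qed.

Let jump_gt0 : 0 < jump%:R :> R. Proof. by rewrite ltr0n. Qed.
Let Z_ge0 w : 0 <= Z w. Proof. by []. Qed.

Lemma species_upper x : 0 < x ->
  (P [set w | (\int[P]_w Z w + x < Z w)%R] <=
   (expR (- (x ^+ 2 / (2 * jump%:R * \int[P]_w Z w + 2 / 3 * jump%:R * x))))%:E)%E.
Proof.
exact: (size_bias_upper jump_gt0 measurable_species_count Z_ge0
  integrable_exp_species species_tilted_le species_tilted_ge).
Qed.

Lemma species_lower x : 0 < x ->
  (P [set w | (Z w < \int[P]_w Z w - x)%R] <=
   expeR (- ((x ^+ 2)%:E / (2 * jump%:R * \int[P]_w Z w)%:E)))%E.
Proof.
exact: (size_bias_lower jump_gt0 measurable_species_count Z_ge0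
  integrable_exp_species species_tilted_le species_tilted_ge).
Qed.

End poisson_law.

(** * Laplace transforms *)

Section laplace_transforms.
Context {R : realType}.
Local Notation leb := (@lebesgue_measure R).
Local Notation Ioo := (`]0%R, +oo[%classic : set R).
Implicit Types (f g w W : R -> R).

Lemma measurable_mul_expR g u : measurable_fun Ioo g ->
  measurable_fun Ioo (fun x => g x * expR (- (u * x))).
Proof.
move=> mg; apply: measurable_funM => //.
apply: measurable_funTS; apply: measurableT_comp => //.
by apply: measurableT_comp => //; exact: measurable_funM.
Qed.

Section derivative.
Variable f : R -> R.
Hypotheses (mf : measurable_fun Ioo f) (f_ge0 : forall x, 0 < x -> 0 <= f x)
  (Lf : laplace_finite f).

Let fexp_ge0 u x : Ioo x -> 0 <= f x * expR (- (u * x)).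
Proof. by rewrite /= in_itv/= andbT => x0; rewrite mulr_ge0 ?expR_ge0 ?f_ge0. Qed.

Lemma integrable_laplace u : 0 < u ->
  leb.-integrable Ioo (EFin \o (fun x => f x * expR (- (u * x)))).
Proof.
move=> u0; apply/integrableP; split.
  by apply/measurable_EFinP; exact: measurable_mul_expR.
apply: le_lt_trans (Lf u0); rewrite le_eqVlt; apply/orP; left; apply/eqP.
by apply: eq_integral => x /set_mem Dx /=; rewrite ger0_norm ?fexp_ge0.
Qed.

Lemma laplaceE u : 0 < u ->
  (\int[leb]_(x in Ioo) (f x * expR (- (u * x)))%:E = (laplace f u)%:E)%E.
Proof.
move=> u0; rewrite /laplace /Rintegral fineK//.
exact: integrable_fin_num (integrable_laplace u0).
Qed.

Let der u x : is_derive u (1 : R) (fun v => f x * expR (- (v * x)))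
  (- (x * (f x * expR (- (u * x))))).
Proof. by apply: is_derive_eq; rewrite /GRing.scale/=; ring. Qed.

Let derE u x : partial1of2 (fun v x => f x * expR (- (v * x))) u x =
  - (x * (f x * expR (- (u * x)))).
Proof. by rewrite partial1of2E; have [_ ->] := der u x. Qed.

(* Since v > u / 2, the exponential is at most exp (- (u / 4 * x)) squared, and one
   of the two factors absorbs x. *)
Let dom (u v x : R) : 0 < u -> u / 2 < v -> 0 < x ->
  x * (f x * expR (- (v * x))) <= 4 / u * (f x * expR (- (u / 4 * x))).
Proof.
move=> u0 uv x0; rewrite mulrCA [leRHS]mulrCA; apply: ler_wpM2l; first exact: f_ge0.
have h : u / 4 * x <= expR (u / 4 * x) by have := expR_ge1Dx (u / 4 * x); lra.
have e : expR (- (v * x)) <= expR (- (u / 4 * x)) * expR (- (u / 4 * x)).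
  by rewrite -expRD ler_expR; nra.
apply: (@le_trans _ _ (x * (expR (- (u / 4 * x)) * expR (- (u / 4 * x))))).
  by apply: ler_wpM2l => //; exact: ltW.
rewrite mulrA; apply: ler_wpM2r; first exact: expR_ge0.
rewrite expRN ler_pdivrMr ?expR_gt0//.
by rewrite -ler_pdivrMl ?divr_gt0// invf_div.
Qed.

Let Idom (u : R) : (`]u / 2, 2 * u[%classic : set R) = [set v | u / 2 < v < 2 * u].
Proof. by apply/seteqP; split => v; rewrite /= in_itv. Qed.

Lemma integrable_moment u : 0 < u ->
  leb.-integrable Ioo (EFin \o (fun x => x * (f x * expR (- (u * x))))).
Proof.
move=> u0; have u4 : 0 < u / 4 by lra.
apply: le_integrable (integrableZl _ (4 / u) (integrable_laplace u4)) => //.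
  apply/measurable_EFinP; apply: measurable_funM => //.
  exact: measurable_mul_expR.
move=> x /= Dx; have := Dx; rewrite in_itv/= andbT => x0.
rewrite lee_fin ger0_norm; last by rewrite mulr_ge0 ?fexp_ge0// ltW.
rewrite ger0_norm; last by rewrite mulr_ge0 ?fexp_ge0 ?divr_ge0// ltW.
by apply: dom => //; lra.
Qed.

(** Differentiation under the integral sign, dominated for [v > u / 2]. *)
Lemma momentE u : 0 < u ->
  (\int[leb]_(x in Ioo) (x * (f x * expR (- (u * x))))%:E =
   (- (laplace f)^`()%classic u)%:E)%E.
Proof.
move=> u0; have u4 : 0 < u / 4 by lra.
have Iu : (`]u / 2, 2 * u[%classic : set R) u by rewrite Idom/=; apply/andP; split; lra.
pose G x := `|4 / u * (f x * expR (- (u / 4 * x)))|.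
rewrite (@differentiation_under_integral _ _ _ leb
  (fun v x => f x * expR (- (v * x))) Ioo _ u (u / 2) (2 * u) Iu _ _ G)//.
- under eq_Rintegral do rewrite derE -mulN1r.
  rewrite RintegralZl//; last exact: integrable_moment.
  rewrite mulN1r opprK /Rintegral fineK//.
  exact: integrable_fin_num (integrable_moment u0).
- by move=> v; rewrite Idom/= => /andP[uv _]; apply: integrable_laplace; lra.
- by move=> y; exact: normr_ge0.
- exact: integrable_norm (integrableZl _ (4 / u) (integrable_laplace u4)).
- move=> v x; rewrite Idom/= => /andP[uv _] Dx; rewrite derE normrN.
  move: (Dx); rewrite in_itv/= andbT => x0.
  rewrite /G !ger0_norm ?mulr_ge0 ?expR_ge0 ?f_ge0 ?invr_ge0 ?(ltW u0) ?(ltW x0)//.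
  exact: dom.
Qed.

End derivative.

Section scaling.
Local Open Scope ereal_scope.

Let scale_measurable (u : R) : measurable_fun [set: R] (fun x : R => (u * x)%R).
Proof. exact: measurable_funM. Qed.

(** The two sides are measures in [A] that agree on half-open intervals. *)
Lemma lebesgue_measure_scale (u : R) (A : set R) : (0 < u)%R -> measurable A ->
  leb A = u%:E * pushforward leb (fun x => u * x : measurableTypeR R)%R A.
Proof.
move=> u0 mA.
apply: (@lebesgue_measure_unique R (mscale (NngNum (ltW u0)) _)) mA.
  exact: scale_measurable.
move=> mphi _ [[a b]] _ <- /=.
transitivity (u%:E * leb ((fun x => u * x)%R @^-1` `]a, b])); last by [].
rewrite (_ : _ @^-1` _ = `](u^-1 * a)%R, (u^-1 * b)%R]%classic); last first.
  apply/seteqP; split => x /=; rewrite !in_itv/= => /andP[ax xb];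
    apply/andP; split.
  - by rewrite mulrC ltr_pdivrMr// mulrC.
  - by rewrite [leRHS]mulrC ler_pdivlMr// mulrC.
  - by move: ax; rewrite mulrC ltr_pdivrMr// mulrC.
  - by move: xb; rewrite [leRHS]mulrC ler_pdivlMr// mulrC.
rewrite !lebesgue_measure_itv/= !lte_fin ltr_pM2l ?invr_gt0//.
case: ifPn => _; last by rewrite mule0.
by rewrite -!EFinB -EFinM; congr EFin; field; rewrite gt_eqF.
Qed.

Lemma integral_scale (u : R) (h : R -> \bar R) : (0 < u)%R ->
  measurable_fun Ioo h -> (forall x, (0 < x)%R -> 0 <= h x) ->
  \int[leb]_(x in Ioo) h x = u%:E * \int[leb]_(x in Ioo) h (u * x)%R.
Proof.
move=> u0 mh h0.
have h0' : {in Ioo, forall y, 0 <= h y}.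
  by move=> x; rewrite inE/= in_itv/= andbT; exact: h0.
pose phi : measurableTypeR R -> measurableTypeR R := fun x => (u * x)%R.
have mphi : measurable_fun [set: measurableTypeR R] phi.
  exact: scale_measurable.
have pre : phi @^-1` Ioo = Ioo.
  by apply/seteqP; split => x; rewrite /phi /= !in_itv/= !andbT pmulr_rgt0.
have -> : \int[leb]_(x in Ioo) h (u * x)%R =
  \int[leb]_(x in phi @^-1` Ioo) (h \o phi) x by rewrite pre.
rewrite -(ge0_integral_pushforward mphi)//.
rewrite -(@ge0_integral_mscale _ _ _ _ _ _ (NngNum (ltW u0)))//; last first.
  by move=> x Dx; apply: h0'; rewrite inE.
by apply: eq_measure_integral => A mA _; exact: lebesgue_measure_scale.
Qed.

End scaling.

Section power.
Variable al : R.
Let g x := x `^ (- al).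

Lemma measurable_powRN : measurable_fun Ioo g.
Proof. by apply: measurable_funTS; exact: measurable_powR. Qed.

Lemma powRN_ge0 x : 0 <= g x.
Proof. exact: powR_ge0. Qed.

Lemma integral_powRN_expR u : 0 < u ->
  (\int[leb]_(x in Ioo) (g x * expR (- (u * x)))%:E = (u `^ (al - 1))%:E *
   \int[leb]_(x in Ioo) (g x * expR (- x))%:E)%E.
Proof.
move=> u0.
have mh : measurable_fun Ioo (EFin \o (fun x : R => g x * expR (- x))).
  apply/measurable_EFinP; have := measurable_mul_expR 1 measurable_powRN.
  by apply: eq_measurable_fun => x _; rewrite mul1r.
rewrite (integral_scale u0 mh); last first.
  by move=> x x0; rewrite lee_fin mulr_ge0 ?powRN_ge0 ?expR_ge0.
rewrite muleA -EFinM.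
have -> : u `^ (al - 1) * u = u `^ al.
  by rewrite -[X in _ * X = _](powRr1 (ltW u0)) -powRD ?subrK// (gt_eqF u0) implybT.
rewrite /= -ge0_integralZl ?lee_fin ?powR_ge0//; last 2 first.
- apply/measurable_EFinP.
  apply: measurable_funM.
    apply: measurable_funTS; apply: measurableT_comp; first exact: measurable_powR.
    exact: measurable_funM.
  apply: measurable_funTS; apply: measurableT_comp => //.
  by apply: measurableT_comp => //; exact: measurable_funM.
- by move=> x _; rewrite lee_fin mulr_ge0 ?powRN_ge0 ?expR_ge0.
apply: eq_integral => x; rewrite inE/= in_itv/= andbT => x0.
rewrite -EFinM /g powRM ?ltW// mulrA mulrA -powRD ?subrr ?powRr0 ?mul1r//.
by rewrite (gt_eqF u0) implybT.
Qed.

(* Finiteness at one point is enough, by scaling. *)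
Hypothesis Lg : exists2 u, 0 < u &
  (\int[leb]_(x in Ioo) (g x * expR (- (u * x)))%:E < +oo)%E.

Lemma integral_Gamma :
  (\int[leb]_(x in Ioo) (g x * expR (- x))%:E = (Gamma (1 - al))%:E)%E.
Proof.
have e0 : (0 <= \int[leb]_(x in Ioo) (g x * expR (- x))%:E)%E.
  by apply: integral_ge0 => x _; rewrite lee_fin mulr_ge0 ?powRN_ge0 ?expR_ge0.
have fin : (\int[leb]_(x in Ioo) (g x * expR (- x))%:E)%E \is a fin_num.
  rewrite ge0_fin_numE//; have [u u0] := Lg; rewrite integral_powRN_expR//.
  move: e0; case: (\int[leb]_(x in Ioo) _)%E => [r _ _|_|//]; first exact: ltry.
  by rewrite gt0_muley// lte_fin powR_gt0.
rewrite -[LHS]fineK// /Gamma /Rintegral; congr (fine _)%:E.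
by apply: eq_integral => x _; rewrite /g (_ : 1 - al - 1 = - al)//; ring.
Qed.

Lemma laplace_finite_powRN : laplace_finite g.
Proof.
by move=> u u0; rewrite integral_powRN_expR// integral_Gamma -EFinM ltry.
Qed.

Lemma laplace_powRN u : 0 < u -> laplace g u = Gamma (1 - al) * u `^ (al - 1).
Proof.
move=> u0; apply: EFin_inj.
rewrite -(laplaceE measurable_powRN (fun x _ => powRN_ge0 x) laplace_finite_powRN u0).
by rewrite integral_powRN_expR// integral_Gamma -EFinM mulrC.
Qed.

(** The reduction formula for [Gamma (2 - al)], in the form of the derivative of
    the Laplace transform of the power. *)
Lemma derive_laplace_powRN u : 0 < u ->
  (laplace g)^`()%classic u = Gamma (1 - al) * ((al - 1) * u `^ (al - 2)).
Proof.
move=> u0; rewrite derive1E.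
have nearE : \near u, Gamma (1 - al) * u `^ (al - 1) = laplace g u.
  near=> v; rewrite laplace_powRN//; near: v; exact: lt_nbhsr.
have d1 : is_derive u (1 : R) (fun v => Gamma (1 - al) * v `^ (al - 1))
    (Gamma (1 - al) * ((al - 1) * u `^ (al - 2))).
  have := is_derive1_powR (al - 1) u0 => d0.
  have := is_deriveZ (Gamma (1 - al)) d0.
  rewrite /GRing.scale/= (_ : al - 1 - 1 = al - 2)//; ring.
by have [_ ->] := near_eq_is_derive nearE d1.
Unshelve. all: by end_near. Qed.

End power.
End laplace_transforms.

(** * Means of species counts as Laplace transforms *)

Section layer_cake.
Context {R : realType}.
Local Notation leb := (@lebesgue_measure R).
Local Notation Ioo := (`]0%R, +oo[%classic : set R).
Variables (w W : R -> R).
Hypotheses (dW : forall x, is_derive x (1 : R) W (w x)) (cw : continuous w)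
  (w_ge0 : forall x, 0 <= x -> 0 <= w x) (W0 : W 0 = 0).

Let mw (D : set R) : measurable_fun D w.
Proof. by apply: measurable_funTS; exact: continuous_measurable_fun. Qed.

Let indE (M x : R) : ((x%:E < M%:E)%E%:R = \1_(`]-oo, M[%classic : set R) x :> R).
Proof.
rewrite indicE lte_fin; congr (nat_of_bool _)%:R.
by apply/idP/idP; rewrite inE/= in_itv.
Qed.

Let m_ind (D : set R) (M : R) :
  measurable_fun D (fun x : R => ((w x)%:E * (x%:E < M%:E)%E%:R%:E)%E).
Proof.
under eq_fun do rewrite indE -EFinM.
by apply/measurable_EFinP; apply: measurable_funM.
Qed.

Lemma layer_cake (M : R) : 0 <= M ->
  (\int[leb]_(x in Ioo) ((w x)%:E * (x%:E < M%:E)%E%:R%:E) = (W M)%:E)%E.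
Proof.
rewrite le_eqVlt => /predU1P[<-|M0].
  rewrite W0; apply: integral0_eq => x; rewrite /= in_itv/= andbT => x0.
  by rewrite lte_fin ltNge ltW//= mule0.
have -> : (\int[leb]_(x in Ioo) ((w x)%:E * (x%:E < M%:E)%E%:R%:E) =
    \int[leb]_(x in Ioo `&` `]-oo, M[) (w x)%:E)%E.
  rewrite integral_mkcondr; apply: eq_integral => x _.
  rewrite indE /patch indicE; case: (_ \in _); first by rewrite mule1.
  by rewrite mule0.
have -> : Ioo `&` `]-oo, M[ = `]0, M[%classic.
  apply/seteqP; split => x /=; rewrite !in_itv/= andbT.
    by move=> [-> ->].
  by move=> /andP[].
have mwE (D : set R) : measurable_fun D (EFin \o w) by apply/measurable_EFinP.
rewrite integral_itv_bndo_bndc// integral_itv_obnd_cbnd//.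
have cW : continuous W.
  by move=> x; apply: differentiable_continuous; apply/derivable1_diffP; case: (dW x).
rewrite (@continuous_FTC2 _ _ W)//.
- by rewrite W0 sube0.
- by apply: continuous_subspaceT.
- split; first by move=> x _; case: (dW x).
  + exact: cvg_at_right_filter (cW 0).
  + exact: cvg_at_left_filter (cW M).
- by move=> x _; rewrite derive1E; case: (dW x).
Qed.

Variables (S : countType) (mu : probability {fset S} R).

(** [incidence_prob] as a real number, in the form in which [poisson_thinning]
    involves it. *)
Definition incidence s : R := thin_mass (mass mu) (fun A => s \in A).

Lemma incidence_ge0 s : 0 <= incidence s.
Proof. exact: (thin_mass_ge0 (mass_ge0 mu) (mass1 mu)). Qed.

Lemma incidence_probE s : incidence_prob mu s = (incidence s)%:E.
Proof.
rewrite -(thin_massE (mass_ge0 mu) (mass1 mu) (fun A => s \in A)) /incidence_prob.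
by apply: eq_esum => A _; rewrite massE.
Qed.

(** The layer cake formula summed over the species: [M] is the measure of
    [x < M], and the number of species of incidence above [x] is the incidence
    count. *)
Lemma esum_layer_cake :
  (\esum_(s in [set: S]) (W (incidence s))%:E =
   \int[leb]_(x in Ioo) ((w x)%:E * incidence_count mu x))%E.
Proof.
under eq_esum => s _ do rewrite -(layer_cake (incidence_ge0 s)).
rewrite -integral_esum//; last 2 first.
- by move=> s; exact: m_ind.
- by move=> s x; rewrite /= in_itv/= andbT => x0; rewrite mule_ge0 ?lee_fin ?w_ge0// ltW.
apply: eq_integral => x; rewrite inE/= in_itv/= andbT => x0.
rewrite esumZl ?lee_fin ?w_ge0 ?(ltW x0)//.
congr (_ * _)%E; apply: eq_esum => s _.
by rewrite incidence_probE.
Qed.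

Lemma measurable_incidence_count : measurable_fun Ioo (incidence_count mu).
Proof.
under [X in measurable_fun _ X]eq_fun => x.
  rewrite /incidence_count esum_countType; last by move=> s; rewrite lee_fin.
  over.
apply: ge0_emeasurable_sum => [n x _ _|n _].
  by case: pickle_inv => //= s; rewrite lee_fin.
case: pickle_inv => [s|] /=; last exact: measurable_cst.
rewrite (_ : (fun x => _) = EFin \o \1_(`]-oo, incidence s[%classic : set R)).
  by apply/measurable_EFinP; apply: measurable_funTS; exact: measurable_indic.
by apply/funext => x /=; rewrite incidence_probE indE.
Qed.

Variables (c al : R) (f : R -> R).
Hypotheses (c0 : 0 < c) (mf : measurable_fun Ioo f)
  (f_ge0 : forall x, 0 < x -> 0 <= f x)
  (hnu : forall x : R, 0 < x ->
    (`| incidence_count mu x - (c * x `^ (- al))%:E | <= (f x)%:E)%E).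

Let nu_ge0 x : (0 <= incidence_count mu x)%E.
Proof. by apply: esum_ge0 => s _; rewrite lee_fin. Qed.

Let nu_bounds x : 0 < x ->
  (incidence_count mu x <= c%:E * (x `^ (- al))%:E + (f x)%:E)%E /\
  (c%:E * (x `^ (- al))%:E <= incidence_count mu x + (f x)%:E)%E.
Proof.
move=> x0; have := hnu x0; have := nu_ge0 x.
case: (incidence_count mu x) => [v _|_|//] /=; last by rewrite leye_eq.
by rewrite -!EFinM -!EFinD !lee_fin ler_distl => /andP[h1 h2]; split; lra.
Qed.

Section comparison.
Variables (E F : R).
Hypotheses (hE : (\int[leb]_(x in Ioo) ((w x)%:E * incidence_count mu x) = E%:E)%E)
  (hF : (\int[leb]_(x in Ioo) ((w x)%:E * (f x)%:E) = F%:E)%E).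

Let mwE : measurable_fun Ioo (EFin \o w). Proof. exact/measurable_EFinP. Qed.
Let mpow : measurable_fun Ioo (fun x : R => (x `^ (- al))%:E).
Proof. by apply/measurable_EFinP; exact: measurable_powRN. Qed.
Let mfE : measurable_fun Ioo (EFin \o f). Proof. exact/measurable_EFinP. Qed.
Let w0E x : Ioo x -> (0 <= (w x)%:E)%E.
Proof. by rewrite /= in_itv/= andbT => x0; rewrite lee_fin w_ge0// ltW. Qed.
Let f0E x : Ioo x -> (0 <= (f x)%:E)%E.
Proof. by rewrite /= in_itv/= andbT => x0; rewrite lee_fin f_ge0. Qed.
Let pow0E x : (0 <= (x `^ (- al))%:E)%E. Proof. by rewrite lee_fin powR_ge0. Qed.

Let integral_le (g h : R -> \bar R) :
  measurable_fun Ioo g -> measurable_fun Ioo h ->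
  (forall x, 0 <= g x)%E -> (forall x, 0 <= h x)%E ->
  (forall x : R, (0 < x)%R -> g x <= h x + (f x)%:E)%E ->
  (\int[leb]_(x in Ioo) ((w x)%:E * g x) <=
   \int[leb]_(x in Ioo) ((w x)%:E * h x) + F%:E)%E.
Proof.
move=> mg mh g0 h0 gh; rewrite -hF -ge0_integralD//=.
- apply: ge0_le_integral => //=.
  + by move=> x Dx; rewrite mule_ge0// w0E.
  + exact: emeasurable_funM.
  + by apply: emeasurable_funD; exact: emeasurable_funM.
  + move=> x Dx; rewrite -ge0_muleDr ?f0E// lee_wpmul2l ?w0E//.
    by apply: gh; move: Dx; rewrite in_itv/= andbT.
- by move=> x Dx; rewrite mule_ge0// w0E.
- exact: emeasurable_funM.
- by move=> x Dx; rewrite mule_ge0 ?w0E ?f0E.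
- exact: emeasurable_funM.
Qed.

Let integralZ :
  (\int[leb]_(x in Ioo) ((w x)%:E * (c%:E * (x `^ (- al))%:E)) =
   c%:E * \int[leb]_(x in Ioo) ((w x)%:E * (x `^ (- al))%:E))%E.
Proof.
rewrite -ge0_integralZl//.
- by apply: eq_integral => x _; rewrite muleCA.
- exact: emeasurable_funM.
- by move=> x Dx; rewrite mule_ge0// w0E.
- by rewrite lee_fin ltW.
Qed.

Let mcpow : measurable_fun Ioo (fun x : R => c%:E * (x `^ (- al))%:E)%E.
Proof. exact: emeasurable_funM. Qed.
Let cpow0 x : (0 <= c%:E * (x `^ (- al))%:E)%E.
Proof. by rewrite mule_ge0 ?lee_fin ?powR_ge0// ltW. Qed.

(** Finiteness is inherited from the incidence count, since
    [c * x ^ (- al) <= nu x + f x]. *)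
Lemma power_integral_fin :
  (\int[leb]_(x in Ioo) ((w x)%:E * (x `^ (- al))%:E) < +oo)%E.
Proof.
have := integral_le mcpow measurable_incidence_count cpow0 nu_ge0
  (fun x x0 => (nu_bounds x0).2).
rewrite integralZ hE -EFinD => h.
have : (c%:E * \int[leb]_(x in Ioo) ((w x)%:E * (x `^ (- al))%:E) < +oo)%E.
  exact: le_lt_trans h (ltry _).
case: (\int[leb]_(x in Ioo) _)%E => [r _||_]; rewrite ?ltry ?ltNyr//.
by rewrite gt0_muley// lte_fin.
Qed.

Lemma incidence_comparison (I : R) :
  (\int[leb]_(x in Ioo) ((w x)%:E * (x `^ (- al))%:E) = I%:E)%E ->
  `|E - c * I| <= F.
Proof.
move=> hI.
have := integral_le mcpow measurable_incidence_count cpow0 nu_ge0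
  (fun x x0 => (nu_bounds x0).2).
have := integral_le measurable_incidence_count mcpow nu_ge0 cpow0
  (fun x x0 => (nu_bounds x0).1).
rewrite integralZ hE hI -!EFinM -!EFinD !lee_fin ler_distl => h1 h2.
by apply/andP; split; lra.
Qed.

End comparison.
End layer_cake.

Section mean_deviation.
Context d (Omega : measurableType d) (R : realType) (P : probability Omega R)
  (S : countType) (mu : probability {fset S} R) (lam : R)
  (Y : Omega -> seq {fset S}) (B : nat) (c al : R) (f : R -> R).
Local Notation leb := (@lebesgue_measure R).
Local Notation Ioo := (`]0%R, +oo[%classic : set R).
Hypotheses (lam0 : 0 < lam) (hY : poisson_sample P mu lam Y)
  (hmu : size_bounded mu B) (c0 : 0 < c) (mf : measurable_fun Ioo f)
  (f_ge0 : forall x, 0 < x -> 0 <= f x) (Lf : laplace_finite f)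
  (hnu : forall x : R, 0 < x ->
    (`| incidence_count mu x - (c * x `^ (- al))%:E | <= (f x)%:E)%E).

Lemma poisson_tail (l : R) k : 0 < l ->
  (\esum_(j in [set j | (k <= j)%N]) (poisson_pmf l j)%:E =
   (1 - \sum_(j < k) poisson_pmf l j)%:E)%E.
Proof.
move=> l0; have := esum_poisson_pmf l0.
rewrite (esumID [set j | (k <= j)%N]) ?setTI; last first.
  by move=> j _; rewrite lee_fin poisson_pmf_ge0.
have -> : (\esum_(j in ~` [set j | (k <= j)%N]) (poisson_pmf l j)%:E =
    (\sum_(j < k) poisson_pmf l j)%:E)%E.
  rewrite (_ : ~` _ = `I_k); last first.
    by apply/seteqP; split => j /=; [move/negP; rewrite -ltnNge|rewrite ltnNge => /negP].
  rewrite esum_fset//; last by move=> j _; rewrite lee_fin poisson_pmf_ge0.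
  by rewrite -fsbig_ord sumEFin.
by move=> h; rewrite EFinB -h addeK.
Qed.

Let occurrence_tail k s (W : R -> R) : (0 < k)%N -> W 0 = 0 ->
  (forall M, 0 < M -> 1 - \sum_(j < k) poisson_pmf (lam * M) j = W M) ->
  (poisson_sum (mass mu) lam (fun x => (k <= occurrences s x)%N%:R%:E) =
   (W (incidence mu s))%:E)%E.
Proof.
move=> k0 W0 hW; have m0 := mass_ge0 mu; have m1 := mass1 mu.
have := incidence_ge0 mu s; rewrite le_eqVlt => /predU1P[M0|M0].
  rewrite -M0 W0; have := @poisson_sum_count0 _ _ _ m0 m1 lam
    (fun A : {fset S} => s \in A) k k0 (cst 1%E).
  under [X in poisson_sum _ _ X]eq_fun do rewrite mule1.
  by apply=> //; rewrite -/(incidence mu s) -M0.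
rewrite (poisson_sum_tail m0 m1 lam0 (D := fun A : {fset S} => s \in A) M0).
by rewrite poisson_tail ?mulr_gt0// hW.
Qed.

Let species_mean_kernel k (w W : R -> R) : (0 < k)%N ->
  (forall x, is_derive x (1 : R) W (w x)) -> continuous w ->
  (forall x, 0 <= x -> 0 <= w x) -> W 0 = 0 ->
  (forall M, 0 < M -> 1 - \sum_(j < k) poisson_pmf (lam * M) j = W M) ->
  (\int[leb]_(x in Ioo) ((w x)%:E * incidence_count mu x) =
   (\int[P]_w0 species_count R Y k w0)%:E)%E.
Proof.
move=> k0 dW cw w0 W0 hW; rewrite -(esum_layer_cake dW cw w0 W0).
rewrite (species_mean_esum lam0 hY hmu k0); apply: eq_esum => s _.
by rewrite (occurrence_tail _ k0 W0 hW).
Qed.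

Let g : R -> R := fun x => x `^ (- al).

Let mg : measurable_fun Ioo g. Proof. exact: measurable_powRN. Qed.
Let g0 x : 0 < x -> 0 <= g x. Proof. by move=> _; exact: powR_ge0. Qed.

(* The kernels of the two means and their primitives: W1 M and W2 M are the
   probabilities that a Poisson variable of parameter lam * M is at least 1 and
   at least 2. *)
Let w1 x := lam * expR (- (lam * x)).
Let W1 x := 1 - expR (- (lam * x)).
Let w2 x := lam ^+ 2 * (x * expR (- (lam * x))).
Let W2 x := 1 - (1 + lam * x) * expR (- (lam * x)).

Let dW1 x : is_derive x (1 : R) W1 (w1 x).
Proof. by rewrite /W1 /w1; apply: is_derive_eq; rewrite /GRing.scale/=; ring. Qed.
Let dW2 x : is_derive x (1 : R) W2 (w2 x).
Proof. by rewrite /W2 /w2; apply: is_derive_eq; rewrite /GRing.scale/=; ring. Qed.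

Let cexp : continuous (fun x : R => expR (- (lam * x))).
Proof.
move=> x; apply: differentiable_continuous; apply/derivable1_diffP.
have : is_derive x (1 : R) (fun x : R => expR (- (lam * x))) (- (lam * expR (- (lam * x)))).
  by apply: is_derive_eq; rewrite /GRing.scale/=; ring.
by case.
Qed.

Let cw1 : continuous w1.
Proof. by move=> x; apply: cvgM; [exact: cvg_cst|exact: cexp]. Qed.
Let cw2 : continuous w2.
Proof.
move=> x; apply: cvgM; first exact: cvg_cst.
by apply: cvgM; [exact: cvg_id|exact: cexp].
Qed.

Let w1_ge0 x : 0 <= x -> 0 <= w1 x.
Proof. by move=> _; rewrite /w1 mulr_ge0 ?expR_ge0// ltW. Qed.
Let w2_ge0 x : 0 <= x -> 0 <= w2 x.
Proof. by move=> x0; rewrite /w2 !mulr_ge0 ?expR_ge0 ?exprn_ge0// ltW. Qed.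

Let W1_0 : W1 0 = 0. Proof. by rewrite /W1 mulr0 oppr0 expR0 subrr. Qed.
Let W2_0 : W2 0 = 0.
Proof. by rewrite /W2 mulr0 oppr0 expR0 addr0 mulr1 subrr. Qed.

Let E1 := species_mean_kernel (ltn0Sn 0) dW1 cw1 w1_ge0 W1_0.
Let E2 := species_mean_kernel (ltn0Sn 1) dW2 cw2 w2_ge0 W2_0.

Let hE1 : (\int[leb]_(x in Ioo) ((w1 x)%:E * incidence_count mu x) =
   (\int[P]_w0 species_count R Y 1 w0)%:E)%E.
Proof.
apply: E1 => M M0; rewrite big_ord1 /poisson_pmf mulr_gt0//.
by rewrite expr0 fact0 invr1 !mul1r.
Qed.

Let hE2 : (\int[leb]_(x in Ioo) ((w2 x)%:E * incidence_count mu x) =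
   (\int[P]_w0 species_count R Y 2 w0)%:E)%E.
Proof.
apply: E2 => M M0; rewrite !big_ord_recl big_ord0 /= /poisson_pmf mulr_gt0//.
by rewrite expr0 expr1 !factS fact0 !invr1 /W2; ring.
Qed.

Let int_w1 (h : R -> R) : measurable_fun Ioo h ->
  (forall x, 0 < x -> 0 <= h x) ->
  (\int[leb]_(x in Ioo) ((w1 x)%:E * (h x)%:E) =
   lam%:E * \int[leb]_(x in Ioo) (h x * expR (- (lam * x)))%:E)%E.
Proof.
move=> mh h0; rewrite -ge0_integralZl//.
- by apply: eq_integral => x _; rewrite -!EFinM /w1; congr EFin; ring.
- by apply/measurable_EFinP; exact: measurable_mul_expR.
- move=> x; rewrite /= in_itv/= andbT => x0.
  by rewrite lee_fin mulr_ge0 ?expR_ge0 ?h0.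
- by rewrite lee_fin ltW.
Qed.

Let int_w2 (h : R -> R) : measurable_fun Ioo h ->
  (forall x, 0 < x -> 0 <= h x) ->
  (\int[leb]_(x in Ioo) ((w2 x)%:E * (h x)%:E) =
   (lam ^+ 2)%:E * \int[leb]_(x in Ioo) (x * (h x * expR (- (lam * x))))%:E)%E.
Proof.
move=> mh h0; rewrite -ge0_integralZl//.
- by apply: eq_integral => x _; rewrite -!EFinM /w2; congr EFin; ring.
- apply/measurable_EFinP; apply: measurable_funM => //.
  exact: measurable_mul_expR.
- move=> x; rewrite /= in_itv/= andbT => x0.
  by rewrite lee_fin !mulr_ge0 ?expR_ge0 ?h0// ltW.
- by rewrite lee_fin exprn_ge0// ltW.
Qed.

Let hF1 : (\int[leb]_(x in Ioo) ((w1 x)%:E * (f x)%:E) =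
  (lam * laplace f lam)%:E)%E.
Proof. by rewrite int_w1// laplaceE. Qed.

Let hF2 : (\int[leb]_(x in Ioo) ((w2 x)%:E * (f x)%:E) =
  (- (lam ^+ 2 * (laplace f)^`()%classic lam))%:E)%E.
Proof. by rewrite int_w2// momentE// -EFinM mulrN. Qed.

Let Lg : exists2 u, 0 < u &
  (\int[leb]_(x in Ioo) (g x * expR (- (u * x)))%:E < +oo)%E.
Proof.
exists lam => //.
have := power_integral_fin cw1 w1_ge0 c0 mf f_ge0 hnu hE1 hF1.
rewrite int_w1//; case: (\int[leb]_(x in Ioo) _)%E => [r _||_]; rewrite ?ltry ?ltNyr//.
by rewrite gt0_muley// lte_fin.
Qed.

Let K := c * Gamma (1 - al) * lam `^ al.

Lemma species_mean_deviation :
  `|\int[P]_w species_count R Y 1 w - K| <= lam * laplace f lam.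
Proof.
have -> : K = c * (lam * laplace g lam).
  rewrite (laplace_powRN Lg)// /K.
  have -> : lam `^ al = lam `^ (al - 1) * lam.
    by rewrite -[X in _ = _ * X](powRr1 (ltW lam0)) -powRD ?subrK// (gt_eqF lam0) implybT.
  ring.
apply: (incidence_comparison cw1 w1_ge0 c0 mf f_ge0 hnu hE1 hF1).
by rewrite (int_w1 mg g0) (laplaceE mg g0 (laplace_finite_powRN Lg) lam0).
Qed.

Lemma repeated_species_mean_deviation :
  `|\int[P]_w species_count R Y 2 w - (1 - al) * K| <=
  - (lam ^+ 2 * (laplace f)^`()%classic lam).
Proof.
have -> : (1 - al) * K = c * - (lam ^+ 2 * (laplace g)^`()%classic lam).
  rewrite (derive_laplace_powRN Lg)// /K.
  have -> : lam `^ al = lam `^ (al - 2) * lam ^+ 2.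
    by rewrite -powR_mulrn ?ltW// -powRD ?subrK// (gt_eqF lam0) implybT.
  ring.
apply: (incidence_comparison cw2 w2_ge0 c0 mf f_ge0 hnu hE2 hF2).
by rewrite (int_w2 mg g0) (momentE mg g0 (laplace_finite_powRN Lg) lam0)
  -EFinM mulrN.
Qed.

End mean_deviation.

(** * The expeditions as Poisson samples *)

Section sampling.
Context d (Omega : measurableType d) (R : realType) (P : probability Omega R).
Variables (S : countType) (X : nat -> {RV P >-> {fset S}}) (n m : {RV P >-> nat})
  (mu : probability {fset S} R) (t t' : R).
Hypotheses (t0 : 0 < t) (t'0 : 0 < t')
  (hs : poisson_sampling X n m mu t t').

Definition observed (N : Omega -> nat) w : seq {fset S} :=
  [seq X i w | i <- iota 0 (N w)].

Lemma observed_fiber N x : observed N @^-1` [set x] =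
  N @^-1` [set size x] `&`
  \bigcap_(i in `I_(size x)) (X i @^-1` [set nth fset0 x i]).
Proof.
apply/seteqP; split => w /=.
  move=> <-; rewrite /observed size_map size_iota; split => // i /= iN.
  by rewrite (nth_map 0%N) ?size_iota// nth_iota.
move=> [Nx Xx]; apply: (@eq_from_nth _ fset0).
  by rewrite size_map size_iota.
move=> i; rewrite size_map size_iota Nx => ix.
by rewrite (nth_map 0%N) ?size_iota ?Nx// nth_iota ?Nx// Xx.
Qed.

Lemma prod_fset_seq (I : choiceType) (s : seq I) (F : I -> \bar R) : uniq s ->
  (\prod_(i <- [fset i in s]%fset) F i = \prod_(i <- s) F i)%E.
Proof.
move=> us; apply: perm_big; apply: uniq_perm => // i.
by rewrite !inE.
Qed.

Let joint_event (E : nat -> set Omega) (A B : set Omega) (i : bool + nat) :=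
  match i with inl false => A | inl true => B | inr i => E i end.

Let sample_event (x : seq {fset S}) i := X i @^-1` [set nth fset0 x i].

Let sigmaN (N : {RV P >-> nat}) j :
  preimage_set_system [set: Omega] N measurable (N @^-1` [set j]).
Proof. by exists [set j] => //; rewrite setTI. Qed.

Let sigmaX i A :
  preimage_set_system [set: Omega] (X i) measurable (X i @^-1` [set A]).
Proof. by exists [set A] => //; rewrite setTI. Qed.

Let sets_prod x : (\prod_(i <- iota 0 (size x)) P (sample_event x i) =
  \prod_(A <- x) mu [set A])%E.
Proof.
rewrite (big_nth fset0) /index_iota subn0; apply: eq_bigr => i _.
exact: (sampling_law hs).
Qed.

(** Independence for the finite family made of the size of the expedition and of
    the first sets. *)
Lemma first_expedition_prob (x : seq {fset S}) j :
  (P (n @^-1` [set j] `&` \bigcap_(i in `I_(size x)) sample_event x i) =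
   (poisson_pmf t j)%:E * \prod_(A <- x) mu [set A])%E.
Proof.
pose s : seq (bool + nat) := inl false :: [seq inr i | i <- iota 0 (size x)].
have us : uniq s.
  rewrite /= map_inj_uniq ?iota_uniq ?andbT => [|i j' []//].
  by apply/mapP => -[].
(* The size of the second expedition is outside the family: set0 is a default. *)
have := sampling_indep hs => /(_ [fset i in s]%fset
  (joint_event (sample_event x) (n @^-1` [set j]) set0)).
rewrite prod_fset_seq// big_cons big_map sets_prod.
have -> : (\bigcap_(i in [set` [fset i in s]%fset])
   joint_event (sample_event x) (n @^-1` [set j]) set0 i =
   n @^-1` [set j] `&` \bigcap_(i in `I_(size x)) sample_event x i)%classic.
  apply/seteqP; split => w.
    move=> h; split; first by apply: (h (inl false)); rewrite /= !inE.
    move=> i /= ix; apply: (h (inr i)); rewrite /= !inE /=.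
    by rewrite mem_map ?mem_iota// => ? ? [].
  move=> [h1 h2] i /=; rewrite !inE => /predU1P[->//|/mapP[i' + ->]].
  by rewrite mem_iota => /= ?; exact: h2.
move=> ->; first by congr (_ * _)%E; exact: (sampling_poisson1 hs).
move=> i; rewrite !inE => /predU1P[->|/mapP[i' _ ->]]; first exact: sigmaN.
exact: sigmaX.
Qed.

Lemma two_expeditions_prob (x : seq {fset S}) j l :
  (P ((n @^-1` [set j] `&` m @^-1` [set l]) `&`
      \bigcap_(i in `I_(size x)) sample_event x i) =
   ((poisson_pmf t j)%:E * (poisson_pmf t' l)%:E) * \prod_(A <- x) mu [set A])%E.
Proof.
pose s : seq (bool + nat) :=
  [:: inl false, inl true & [seq inr i | i <- iota 0 (size x)]].
have us : uniq s.
  rewrite /= map_inj_uniq ?iota_uniq ?andbT => [|i j' []//].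
  by rewrite inE /=; apply/andP; split; apply/mapP => -[].
have := sampling_indep hs => /(_ [fset i in s]%fset
  (joint_event (sample_event x) (n @^-1` [set j]) (m @^-1` [set l]))).
rewrite prod_fset_seq// !big_cons big_map sets_prod.
have -> : (\bigcap_(i in [set` [fset i in s]%fset])
   joint_event (sample_event x) (n @^-1` [set j]) (m @^-1` [set l]) i =
   (n @^-1` [set j] `&` m @^-1` [set l]) `&`
     \bigcap_(i in `I_(size x)) sample_event x i)%classic.
  apply/seteqP; split => w.
    move=> h; split; first split.
    - by apply: (h (inl false)); rewrite /= !inE.
    - by apply: (h (inl true)); rewrite /= !inE.
    move=> i /= ix; apply: (h (inr i)); rewrite /= !inE /=.
    by rewrite mem_map ?mem_iota// => ? ? [].
  move=> [[h0 h1] h2] i /=; rewrite !inE.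
  move=> /predU1P[->//|/predU1P[->//|/mapP[i' + ->]]].
  by rewrite mem_iota => /= ?; exact: h2.
move=> ->; first rewrite muleA; first congr ((_ * _) * _)%E.
- exact: (sampling_poisson1 hs).
- exact: (sampling_poisson2 hs).
move=> i; rewrite !inE => /predU1P[->|/predU1P[->|/mapP[i' _ ->]]].
- exact: sigmaN.
- exact: sigmaN.
- exact: sigmaX.
Qed.

Let measurable_sets x : measurable (\bigcap_(i in `I_(size x)) sample_event x i).
Proof.
apply: fin_bigcap_measurable => // i _; rewrite -[X in measurable X]setTI.
exact: (measurable_funPT (X i)).
Qed.

Let measurable_level (N : {RV P >-> nat}) j : measurable (N @^-1` [set j]).
Proof. by rewrite -[X in measurable X]setTI; exact: (measurable_funPT N). Qed.

Lemma first_expedition_sample : poisson_sample P mu t (observed n).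
Proof.
split => x; rewrite observed_fiber; last exact: first_expedition_prob.
by apply: measurableI.
Qed.

(** The sum of independent Poisson variables is Poisson; the fiber over a sample is
    split according to the size of the first expedition. *)
Lemma total_sample :
  poisson_sample P mu (t + t') (observed (fun w => n w + m w)%N).
Proof.
have tt0 : 0 < t + t' by rewrite addr_gt0.
have fiberE x : observed (fun w => n w + m w)%N @^-1` [set x] =
    \bigcup_(j in `I_(size x).+1)
      ((n @^-1` [set j] `&` m @^-1` [set (size x - j)%N]) `&`
       \bigcap_(i in `I_(size x)) sample_event x i).
  rewrite observed_fiber; apply/seteqP; split => w /=.
    move=> [nm h]; exists (n w); first by rewrite /= -nm ltnS leq_addr.
    by split => //; split => //=; rewrite -nm addKn.
  by move=> [j /= jx [[-> ->] h]]; split; rewrite // subnKC.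
have mF x j : measurable ((n @^-1` [set j] `&` m @^-1` [set (size x - j)%N]) `&`
       \bigcap_(i in `I_(size x)) sample_event x i).
  by apply: measurableI => //; exact: measurableI.
split => x; rewrite fiberE; first by apply: fin_bigcup_measurable.
rewrite measure_fin_bigcup//; last first.
  by move=> j j' _ _ [w [[[/= <- _] _] [[<- _] _]]].
rewrite -fsbig_ord.
transitivity (\sum_(j < (size x).+1) ((poisson_pmf t j)%:E *
    (poisson_pmf t' (size x - j))%:E * \prod_(A <- x) mu [set A]))%E.
  by apply: eq_bigr => j _; exact: two_expeditions_prob.
rewrite -ge0_sume_distrl; last first.
  by move=> j _; rewrite mule_ge0 ?lee_fin ?poisson_pmf_ge0.
congr (_ * _)%E; under eq_bigr do rewrite -EFinM.
rewrite sumEFin; congr EFin; rewrite /poisson_pmf t0 t'0 tt0.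
set k := size x; rewrite addrC exprDn !mulr_suml; apply: eq_bigr => j _.
have jk : (j <= k)%N by rewrite -ltnS.
have bE : (k`!%:R = 'C(k, j)%:R * (j`!%:R * (k - j)`!%:R) :> R).
  by rewrite -!natrM bin_fact.
rewrite opprD expRD bE -mulr_natr; field.
by rewrite !pnatr_eq0 -!lt0n !fact_gt0 bin_gt0.
Qed.

Lemma count1E s w : count1 X n s w = occurrences s (observed n w).
Proof.
rewrite /count1 /occurrences /observed count_map -sum1_count [RHS]big_mkcond /=.
by rewrite /index_iota subn0; apply: eq_bigr => i _ /=; case: (s \in _).
Qed.

Lemma count12E s w : (count1 X n s w + count2 X n m s w)%N =
  occurrences s (observed (fun w => n w + m w)%N w).
Proof.
rewrite /count1 /count2 -big_cat_nat ?leq_addr//=.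
rewrite /occurrences /observed count_map -sum1_count [RHS]big_mkcond /=.
by rewrite /index_iota subn0; apply: eq_bigr => i _ /=; case: (s \in _).
Qed.

Lemma seen1E w : seen1 X n w = species 1 (observed n w).
Proof. by congr num_species; apply/seteqP; split => s /=; rewrite count1E. Qed.

Lemma seen_twiceE w : seen_twice X n w = species 2 (observed n w).
Proof. by congr num_species; apply/seteqP; split => s /=; rewrite count1E. Qed.

Lemma seen12E w : seen12 X n m w = species 1 (observed (fun w => n w + m w)%N w).
Proof. by congr num_species; apply/seteqP; split => s /=; rewrite count12E. Qed.

(** Hence the exponent of the estimator is [1 - y / x] with [x] the number of
    species seen and [y] that of species seen at least twice. *)
Lemma singletonsD w :
  (Defs.singletons X n w + seen_twice X n w)%N = seen1 X n w.
Proof.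
have f1 := finite_species (observed n w) (ltn0Sn 0).
have f2 := finite_species (observed n w) (ltn0Sn 1).
rewrite seen1E seen_twiceE /species /Defs.singletons /num_species.
set A := [set s | count1 X n s w = 1%N].
have fA : finite_set A.
  by apply: sub_finite_set f1 => s; rewrite /A /= count1E => ->.
rewrite -cardfsUI -fset_setU// -fset_setI//.
rewrite (_ : A `&` _ = set0) ?fset_set0 ?cardfs0 ?addn0; last first.
  by apply/seteqP; split => s //= []; rewrite /A /= count1E => ->.
congr (#|` fset_set _|); apply/seteqP; split => s; rewrite /A /= count1E.
  by move=> [->//|]; exact: ltnW.
by rewrite leq_eqVlt => /predU1P[<-|]; [left|right].
Qed.

End sampling.

(** * The concentration inequality *)

Section species_tails.
Context d (Omega : measurableType d) (R : realType) (P : probability Omega R)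
  (S : countType) (mu : probability {fset S} R) (lam : R)
  (Y : Omega -> seq {fset S}) (B k : nat).
Hypotheses (lam0 : 0 < lam) (hY : poisson_sample P mu lam Y)
  (hmu : size_bounded mu B) (k0 : (0 < k)%N).
Local Notation Z := (species_count R Y k).
Local Notation mean := (\int[P]_w Z w).

Definition deviates (x : R) : set Omega :=
  [set w | mean + x < Z w] `|` [set w | Z w < mean - x].

Let mZ : measurable_fun [set: Omega] Z.
Proof. exact: measurable_species_count hY _. Qed.

Let measurable_above x : measurable [set w | mean + x < Z w].
Proof.
have := mZ measurableT (measurable_itv `]mean + x, +oo[); rewrite setTI.
by congr measurable; apply/seteqP; split=> w /=; rewrite in_itv/= andbT.
Qed.

Let measurable_below x : measurable [set w | Z w < mean - x].
Proof.
have := mZ measurableT (measurable_itv `]-oo, mean - x[); rewrite setTI.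
by congr measurable; apply/seteqP; split=> w /=; rewrite in_itv/=.
Qed.

Lemma measurable_deviates x : measurable (deviates x).
Proof. exact: measurableU. Qed.

Lemma deviatesN x w : ~ deviates x w -> `|Z w - mean| <= x.
Proof.
move=> /not_orP[/= /negP + /negP]; rewrite -!leNgt => h1 h2.
by rewrite ler_distl; apply/andP; split.
Qed.

(** The bound is trivial at [x = 0], where each exponential is 1, also when the
    mean is zero. *)
Lemma deviates_le x (J : R) : 0 <= x -> J = (jump B k)%:R ->
  (P (deviates x) <=
   expeR (- ((x ^+ 2)%:E / ((2 * J)%:E * mean%:E))) +
   expeR (- ((x ^+ 2)%:E / ((2 * J)%:E * mean%:E + (2 / 3 * J * x)%:E))))%E.
Proof.
rewrite le_eqVlt => /predU1P[<-|x0] JE.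
  rewrite expr0n/= !mul0e !oppe0 expeR0.
  by apply: le_trans (probability_le1 P (measurable_deviates 0)) _; rewrite leeDl.
have J0 : 0 < J by rewrite JE ltr0n.
have m0 : 0 <= mean by apply: Rintegral_ge0.
apply: (le_trans (measureU2 _ (measurable_above x) (measurable_below x))).
rewrite addeC; apply: leeD.
  apply: le_trans (species_lower lam0 hY hmu k0 x0) _.
  by rewrite -JE EFinM.
apply: le_trans (species_upper lam0 hY hmu k0 x0) _.
rewrite -EFinM -EFinD inver gt_eqF; last first.
  by rewrite ltr_wpDl ?mulr_ge0 ?mulr_gt0// ltW.
by rewrite -EFinM -EFinN /= -JE.
Qed.

Lemma expectation_species (h : Omega -> nat) :
  (forall w, h w = species k (Y w)) ->
  ('E_P[fun w => (h w)%:R] = mean%:E)%E.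
Proof.
move=> hE; rewrite unlock /Rintegral fineK; last first.
  exact: integrable_fin_num (integrable_species lam0 hY hmu k0).
by apply: eq_integral => w _; rewrite hE.
Qed.

End species_tails.

Theorem theorem31 (R : realType) (S : countType) (mu : probability {fset S} R)
  (d : measure_display) (Omega : measurableType d) (P : probability Omega R)
  (X : nat -> {RV P >-> {fset S}}) (n m : {RV P >-> nat})
  (B : nat) (r t z p c alpha : R) (f : R -> R)
  (hB : (1 <= B)%N) (hr : 0 < r) (ht : 0 < t) (hz : 0 < z)
  (hp : 0 < p < 1) (hc : 0 < c) (halpha : 0 < alpha < 1)
  (hsampling : poisson_sampling X n m mu t (r * t))
  (hmu : size_bounded mu B)
  (hf_meas : measurable_fun (`]0, +oo[ : set R) f)
  (hf_ge0 : forall x : R, 0 < x -> 0 <= f x)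
  (hf_laplace : laplace_finite f)
  (hnu : forall x : R, 0 < x ->
    (`| incidence_count mu x - (c * x `^ (- alpha))%:E | <= (f x)%:E)%E) :
  let q : R := 1 - p in
  let T : R := (1 + r) * t in
  let dz : R := deviation p c alpha r t z in
  let ES_T : \bar R := ('E_P[fun w => (seen12 X n m w)%:R])%E in
  let ES_t : \bar R := ('E_P[fun w => (seen1 X n w)%:R])%E in
  let ES2_t : \bar R := ('E_P[fun w => (seen_twice X n w)%:R])%E in
  let a : R := q * z - T * laplace f T in
  let b : R := dz - t * laplace f t in
  let e : R := dz + t ^+ 2 * (laplace f)^`()%classic t in
  T * laplace f T <= q * z ->
  t * laplace f t <= dz ->
  - (t ^+ 2 * (laplace f)^`()%classic t) <= dz ->
  (P [set w | (z < `| unseen_estimator X n r w - unseen X n m w |)%R]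
   <= expeR (- ((a ^+ 2)%:E / ((2 * B%:R)%:E * ES_T)))
    + expeR (- ((a ^+ 2)%:E / ((2 * B%:R)%:E * ES_T + (2 / 3 * B%:R * a)%:E)))
    + expeR (- ((b ^+ 2)%:E / ((2 * B%:R)%:E * ES_t)))
    + expeR (- ((b ^+ 2)%:E / ((2 * B%:R)%:E * ES_t + (2 / 3 * B%:R * b)%:E)))
    + expeR (- ((e ^+ 2)%:E / ((4 * B%:R - 2)%:E * ES2_t)))
    + expeR (- ((e ^+ 2)%:E
        / ((4 * B%:R - 2)%:E * ES2_t + ((4 * B%:R - 2) / 3 * e)%:E))))%E.
Proof.
move=> q T dz ES_T ES_t ES2_t a b e hT ht1 ht2.
have rt0 : 0 < r * t by exact: mulr_gt0.
have r10 : 0 < 1 + r by rewrite addr_gt0.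
have TE : T = t + r * t by rewrite /T; ring.
have T0 : 0 < T by rewrite TE addr_gt0.
pose Y1 := observed X n; pose Y2 := observed X (fun w => n w + m w)%N.
have hY1 : poisson_sample P mu t Y1 by exact: first_expedition_sample hsampling.
have hY2 : poisson_sample P mu T Y2 by rewrite TE; exact: total_sample.
have devT := species_mean_deviation T0 hY2 hmu hc hf_meas hf_ge0 hf_laplace hnu.
have dev1 := species_mean_deviation ht hY1 hmu hc hf_meas hf_ge0 hf_laplace hnu.
have dev2 := repeated_species_mean_deviation ht hY1 hmu hc hf_meas hf_ge0
  hf_laplace hnu.
pose K := c * Gamma (1 - alpha) * t `^ alpha.
rewrite -/K in dev1 dev2.
pose est (x : seq {fset S}) : R := (species 1 x)%:R *
  ((1 + r) `^ ((species 1 x - species 2 x)%N%:R / (species 1 x)%:R) - 1).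
have estE w : unseen_estimator X n r w = est (Y1 w).
  rewrite /unseen_estimator /est /Y1 -seen1E -seen_twiceE.
  by have -> : (seen1 X n w - seen_twice X n w)%N = Defs.singletons X n w;
    [rewrite -singletonsD addnK|].
have J1 : B%:R = (jump B 1)%:R :> R by rewrite /jump mul1n add1n prednK.
have J2 : 2 * B%:R - 1 = (jump B 2)%:R :> R.
  have BE : B%:R = B.-1%:R + 1 :> R by rewrite -[in LHS](prednK hB) -addn1 natrD.
  by rewrite /jump natrD natrM BE; ring.
have a0 : 0 <= a by rewrite /a subr_ge0.
have b0 : 0 <= b by rewrite /b subr_ge0.
have e0 : 0 <= e by rewrite /e -[X in _ + X]opprK subr_ge0.
have tailT := deviates_le T0 hY2 hmu (ltn0Sn 0) a0 J1.
have tail1 := deviates_le ht hY1 hmu (ltn0Sn 0) b0 J1.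
have tail2 := deviates_le ht hY1 hmu (ltn0Sn 1) e0 J2.
rewrite -(expectation_species T0 hY2 hmu (ltn0Sn 0) (seen12E X n m)) in tailT.
rewrite -(expectation_species ht hY1 hmu (ltn0Sn 0) (seen1E X n)) in tail1.
rewrite -(expectation_species ht hY1 hmu (ltn0Sn 1) (seen_twiceE X n)) in tail2.
have J2E : 2 * (2 * B%:R - 1) = 4 * B%:R - 2 :> R by ring.
have J2E' : 2 / 3 * (2 * B%:R - 1) * e = (4 * B%:R - 2) / 3 * e by ring.
rewrite J2E J2E' in tail2.
set E := [set w | _].
have mE : measurable E.
  have mest : measurable_fun [set: Omega] (fun w => unseen_estimator X n r w).
    under eq_fun do rewrite estE.
    exact: (@measurable_countable_valued _ _ _ _ hY1.1 _ _ est).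
  have muns : measurable_fun [set: Omega] (fun w => unseen X n m w : R).
    under eq_fun do rewrite /unseen seen12E seen1E.
    by apply: measurable_funB;
      [exact: (measurable_species_count hY2)|exact: (measurable_species_count hY1)].
  have := measurable_funB mest muns => /(measurableT_comp (@normr_measurable R setT)).
  move=> /(_ measurableT _ (measurable_itv `]z, +oo[)); rewrite setTI.
  by congr measurable; apply/seteqP; split=> w /=; rewrite in_itv/= andbT.
have PE1 : (P E <= 1)%E by exact: probability_le1.
have Lt0 : 0 <= laplace f t.
  apply: Rintegral_ge0 => x; rewrite /= in_itv/= andbT => x0.
  by rewrite mulr_ge0 ?expR_ge0 ?hf_ge0.
have G0 : 0 <= Gamma (1 - alpha).
  by apply: Rintegral_ge0 => x _; rewrite mulr_ge0 ?powR_ge0 ?expR_ge0.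
have K0 : 0 <= K by rewrite /K !mulr_ge0 ?powR_ge0// ltW.
pose l := ln (1 + r).
have l0 : 0 < l by rewrite ln_gt0// ltrDl.
pose w0 := p * z * (1 + r) `^ (- alpha).
have [p0 _] := andP hp.
have w0_gt0 : 0 < w0 by rewrite !mulr_gt0 ?powR_gt0.
have dzE : dz = w0 * K / ((1 + 2 * l) * K + w0 * (2 - alpha) * l).
  rewrite /dz /deviation /w0 /K /l; congr (_ / _); ring.
have subE : K != 0 -> E `<=` deviates P Y2 1 a `|` deviates P Y1 1 b `|` deviates P Y1 2 e.
  move=> KN0 w /= zw; have {KN0}K0 : 0 < K by rewrite lt_neqAle eq_sym KN0.
  apply: contrapT => /not_orP[/not_orP[/deviatesN hT' /deviatesN h1] /deviatesN h2].
  move: zw; apply/negP; rewrite -leNgt.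
  move: hT' h1 h2; rewrite /species_count -seen12E -seen1E -seen_twiceE.
  set x := (seen1 X n w)%:R; set y := (seen_twice X n w)%:R; set xT := (seen12 X n m w)%:R.
  move=> hT' h1 h2.
  have hx : `|x - K| <= dz.
    by apply: (le_trans (ler_distD _ _ _) (le_trans (lerD h1 dev1) _)); rewrite /b subrK.
  have hy : `|y - (1 - alpha) * K| <= dz.
    apply: (le_trans (ler_distD _ _ _) (le_trans (lerD h2 dev2) _)).
    by rewrite /e -addrA subrr addr0.
  have hxT : `|xT - c * Gamma (1 - alpha) * T `^ alpha| <= q * z.
    by apply: (le_trans (ler_distD _ _ _) (le_trans (lerD hT' devT) _)); rewrite /a subrK.
  have yx : y <= x by rewrite /x -singletonsD natrD lerDr.
  have := estimator_deviation (ler0n _ _) (ler0n _ _) yx l0 K0 halpha w0_gt0 dzE hx hy.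
  (* For x = 0 both sides vanish, whatever the exponent. *)
  have hatE : unseen_estimator X n r w + x =
      (1 + r) `^ alpha * (x * expR (l * (1 - alpha - y / x))).
    rewrite /unseen_estimator -/x; have [->|xn0] := eqVneq x 0.
      by rewrite !mul0r mulr0 addr0.
    have phiE : (Defs.singletons X n w)%:R = x - y :> R.
      by rewrite /x -singletonsD natrD addrK.
    rewrite phiE /powR gt_eqF// mulrCA -expRD.
    rewrite (_ : alpha * ln (1 + r) + _ = (x - y) / x * ln (1 + r)).
      by ring.
    by rewrite /l; field.
  have KTE : c * Gamma (1 - alpha) * T `^ alpha = (1 + r) `^ alpha * K.
    by rewrite /T powRM ?ltW// /K; ring.
  have pzE : p * z = (1 + r) `^ alpha * w0.
    rewrite /w0 mulrCA -powRD ?subrr ?powRr0 ?mulr1//.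
    by rewrite (gt_eqF r10) implybT.
  rewrite -(@ler_pM2l _ ((1 + r) `^ alpha)) ?powR_gt0//.
  rewrite -[X in X * `|_|]ger0_norm ?powR_ge0// -normrM mulrBr -hatE -KTE -pzE => hh.
  have -> : unseen_estimator X n r w - unseen X n m w =
    (unseen_estimator X n r w + x - c * Gamma (1 - alpha) * T `^ alpha) -
    (xT - c * Gamma (1 - alpha) * T `^ alpha).
    by rewrite /unseen -/x -/xT; ring.
  apply: (le_trans (ler_normB _ _) (le_trans (lerD hh hxT) _)).
  by rewrite /q -mulrDl addrC subrK mul1r.
(* If K = 0, then b = 0 and the exponentials with b are 1. *)
have [KZ|Kn0] := eqVneq K 0.
  have bZ : b = 0.
    apply/eqP; rewrite eq_le b0 andbT /b dzE KZ mulr0 mul0r sub0r oppr_le0.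
    exact: mulr_ge0 (ltW ht) Lt0.
  apply: (le_trans PE1); rewrite bZ expr0n/= !mul0e !oppe0 expeR0.
  do 3 (rewrite -[leLHS]adde0; apply: leeD; last by rewrite ?expeR_ge0).
  rewrite -[leLHS]add0e; apply: leeD; last exact: lexx.
  by apply: adde_ge0; exact: expeR_ge0.
suff sumE : (P E <= P (deviates P Y2 1 a) + P (deviates P Y1 1 b) +
    P (deviates P Y1 2 e))%E.
  apply: (le_trans sumE); rewrite -!addeA; apply: (le_trans (leeD2r _ tailT)).
  rewrite -!addeA; do 2 apply: leeD2l; apply: (le_trans (leeD2r _ tail1)).
  by rewrite -!addeA; do 2 apply: leeD2l.
have mDT := measurable_deviates 1 hY2 a.
have mD1 := measurable_deviates 1 hY1 b.
have mD2 := measurable_deviates 2 hY1 e.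
have mU := measurableU _ _ mDT mD1.
apply: (le_trans (le_measure P (mem_set mE)
  (mem_set (measurableU _ _ mU mD2)) (subE Kn0))).
exact: (le_trans (measureU2 _ mU mD2) (leeD2r _ (measureU2 _ mDT mD1))).
Qed.
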